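(* There exists an oracle $A\subseteq\{0,1\}^*$ such that $\mathrm{EQP}^{\mathrm{ZPP}^A}\not\subseteq\mathrm{NQP}^A$. In particular, $\mathrm{ZQP}^{\mathrm{ZQP}^A}\not\subseteq\mathrm{ZQP}^A$.
   Context: For an oracle $A$, $\mathrm{EQP}^A$, $\mathrm{ZQP}^A$, $\mathrm{NQP}^A$ are the classes of languages $L$ decided by a polynomial-time quantum oracle machine (with algebraic amplitudes, making quantum queries to $A$) that respectively: accepts $x\in L$ with probability $1$ and rejects $x\notin L$ with probability $1$ (EQP); on every input outputs the correct answer with probability at least $1/2$ and never outputs the incorrect answer, otherwise outputting ''don't know'' (ZQP); accepts with positive probability iff $x\in L$ (NQP). $\mathrm{ZPP}^A$ is the class of languages decided by a polynomial-time classical randomized oracle machine in the zero-error sense (correct with probability at least $1/2$, never incorrect, otherwise ''don't know''). For a class $S$ of oracles, $\mathcal{C}^S=\bigcup_{B\in S}\mathcal{C}^B$. *)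

(* Defs.v *)
From HB Require Import structures.
From mathcomp Require Import all_boot all_order all_algebra all_field.
Set Implicit Arguments. Unset Strict Implicit. Unset Printing Implicit Defensive.
Import Order.TTheory GRing.Theory Num.Theory.

Definition lang := seq bool -> bool.

(* States 'I_(Q+1) (start state = 0), tape symbols 'I_(S+3):
   0 = blank, 1 = bit 0, 2 = bit 1, others = work symbols.
   delta returns None to halt; the bool ins the move (true = right). *)
Record TM := MkTM {
  tmQ : nat; tmS : nat;
  tm_delta : 'I_tmQ.+1 -> 'I_tmS.+3 -> option ('I_tmQ.+1 * 'I_tmS.+3 * bool) }.

Record config (M : TM) := Config {
  c_state : 'I_(tmQ M).+1;
  c_left : seq 'I_(tmS M).+3;   (* cells left of the head, nearest first *)
  c_cur : 'I_(tmS M).+3;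
  c_right : seq 'I_(tmS M).+3 }.

Definition blank (M : TM) : 'I_(tmS M).+3 := ord0.
Definition sym_of_bit (M : TM) (b : bool) : 'I_(tmS M).+3 :=
  if b then inord 2 else inord 1.

Definition tm_step (M : TM) (c : config M) : option (config M) :=
  match tm_delta (c_state c) (c_cur c) with
  | None => None
  | Some (q, s, d) =>
      Some (if d then Config q (s :: c_left c) (head (blank M) (c_right c)) (behead (c_right c))
            else Config q (behead (c_left c)) (head (blank M) (c_left c)) (s :: c_right c))
  end.

(* run M n c = Some c' iff M halts from c within n-1 steps in halted configuration c'. *)
Fixpoint tm_run (M : TM) (n : nat) (c : config M) : option (config M) :=
  match n with
  | 0 => None
  | n'.+1 => match tm_step c with None => Some c | Some c' => @tm_run M n' c' end
  end.

Definition init_config (M : TM) (x : seq bool) : config M :=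
  Config (ord0 : 'I_(tmQ M).+1) [::] (head (blank M) (map (sym_of_bit M) x))
         (behead (map (sym_of_bit M) x)).

Fixpoint read_bits (n : nat) (s : seq 'I_n) : seq bool :=
  match s with
  | [::] => [::]
  | a :: s' => if val a == 1 then false :: read_bits s'
               else if val a == 2 then true :: read_bits s' else [::]
  end.

Definition tm_output (M : TM) (c : config M) : seq bool := read_bits (c_cur c :: c_right c).

Definition poly_computable (f : seq bool -> seq bool) : Prop :=
  exists (M : TM) (k : nat), forall x : seq bool,
    exists c, @tm_run M (size x ^ k + k).+1 (init_config M x) = Some c /\ tm_output c = f x.

(* A bit string encodes a list of lists of naturals: the number n ins 1^(n+1) 0,
   and a lone 0 separates consecutive lists. *)
Fixpoint blocks (s : seq bool) (acc : nat) : seq nat :=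
  match s with
  | [::] => [::]
  | true :: s' => blocks s' acc.+1
  | false :: s' => acc :: blocks s' 0
  end.

Fixpoint group_blocks (l : seq nat) (cur : seq nat) : seq (seq nat) :=
  match l with
  | [::] => [:: rev cur]
  | 0 :: l' => rev cur :: group_blocks l' [::]
  | k.+1 :: l' => group_blocks l' (k :: cur)
  end.

Definition decode (s : seq bool) : seq (seq nat) := group_blocks (blocks s 0) [::].

Local Open Scope ring_scope.

(* a k-qubit gate given by its matrix entries U[out, in] (entries in algC, the
   algebraic numbers) *)
Definition gate := (nat * (seq bool -> seq bool -> algC))%type.
Definition dflt_gate : gate := (0%N, fun _ _ => 0).

Definition unitary_gate (g : gate) : Prop :=
  forall a b : g.1.-tuple bool,
    \sum_(c : g.1.-tuple bool) (g.2 c a)^* * g.2 c b = (a == b)%:R.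

Inductive qinstr :=
  | QGate of nat & seq nat      (* gate index in the gate set, target qubits *)
  | QOracle of seq nat & nat.   (* query register, answer qubit: |y,b> -> |y, b xor A(y)> *)

Definition parse_qinstr (l : seq nat) : option qinstr :=
  match l with
  | 0%N :: g :: ps => Some (QGate g ps)
  | 1%N :: t :: qs => Some (QOracle qs t)
  | _ => None
  end.

Fixpoint parse_qinstrs (ls : seq (seq nat)) : option (seq qinstr) :=
  match ls with
  | [::] => Some [::]
  | l :: ls' => match parse_qinstr l, parse_qinstrs ls' with
                | Some i, Some ins => Some (i :: ins)
                | _, _ => None
                end
  end.

(* header [:: m] = number of qubits, then the instructions *)
Definition parse_q (ls : seq (seq nat)) : option (nat * seq qinstr) :=
  match ls with
  | [:: m] :: rest => omap (fun ins => (m, ins)) (parse_qinstrs rest)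
  | _ => None
  end.

Definition valid_qinstr (G : seq gate) (m : nat) (i : qinstr) : bool :=
  match i with
  | QGate g ps => [&& (g < size G)%N, size ps == (nth dflt_gate G g).1, uniq ps
                    & all (fun p => (p < m)%N) ps]
  | QOracle qs t => uniq (t :: qs) && all (fun p => (p < m)%N) (t :: qs)
  end.

Definition getbits (b : seq bool) (ps : seq nat) : seq bool := map (nth false b) ps.
Definition setbits (b : seq bool) (ps : seq nat) (c : seq bool) : seq bool :=
  foldl (fun b' pv => set_nth false b' pv.1 pv.2) b (zip ps c).

(* states: amplitude functions on basis strings (only length-m strings matter) *)
Definition qstate := seq bool -> algC.

Definition apply_gate (U : gate) (ps : seq nat) (psi : qstate) : qstate :=
  fun b => \sum_(c : U.1.-tuple bool) U.2 (getbits b ps) c * psi (setbits b ps c).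

Definition apply_oracle (A : lang) (qs : seq nat) (t : nat) (psi : qstate) : qstate :=
  fun b => psi (set_nth false b t (nth false b t (+) A (getbits b qs))).

Definition apply_qinstr (G : seq gate) (A : lang) (psi : qstate) (i : qinstr) : qstate :=
  match i with
  | QGate g ps => apply_gate (nth dflt_gate G g) ps psi
  | QOracle qs t => apply_oracle A qs t psi
  end.

Definition init_state (x : seq bool) (m : nat) : qstate :=
  fun b => if b == x ++ nseq (m - size x) false then 1 else 0.

Definition final_state (G : seq gate) (A : lang) (m : nat) (ins : seq qinstr)
  (x : seq bool) : qstate := foldl (apply_qinstr G A) (init_state x m) ins.

Definition prob_of (m : nat) (P : seq bool -> bool) (psi : qstate) : algC :=
  \sum_(b : m.-tuple bool | P b) `|psi b| ^+ 2.

Definition qwf (G : seq gate) (f : seq bool -> seq bool) (x : seq bool) : Prop :=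
  exists m ins, parse_q (decode (f x)) = Some (m, ins) /\ (size x <= m)%N /\
               all (valid_qinstr G m) ins.

Definition qprob (G : seq gate) (f : seq bool -> seq bool) (A : lang) (x : seq bool)
  (P : seq bool -> bool) : algC :=
  match parse_q (decode (f x)) with
  | Some (m, ins) => prob_of m P (final_state G A m ins x)
  | None => 0
  end.

Definition qfamily (G : seq gate) (f : seq bool -> seq bool) : Prop :=
  [/\ forall i, (i < size G)%N -> unitary_gate (nth dflt_gate G i),
      poly_computable f & forall x, qwf G f x].

(* output qubit 0 = answer, qubit 1 = "success" flag (ZQP) *)
Definition EQP (A : lang) (L : lang) : Prop :=
  exists G f, qfamily G f /\
    forall x, qprob G f A x (fun b => nth false b 0) = (L x)%:R.

Definition NQP (A : lang) (L : lang) : Prop :=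
  exists G f, qfamily G f /\
    forall x, (0 < qprob G f A x (fun b => nth false b 0)) = L x.

Definition ZQP (A : lang) (L : lang) : Prop :=
  exists G f, qfamily G f /\
    forall x,
      qprob G f A x (fun b => nth false b 1 && (nth false b 0 != L x)) = 0 /\
      2%:R^-1 <= qprob G f A x (fun b => nth false b 1 && (nth false b 0 == L x)).

(* wires are computed in order; instruction lists:
   [0; b] constant (b != 0), [1; i] input bit x_i, [2; j] random bit r_j,
   [3; i; j] NAND of earlier wires i, j, 4 :: qs oracle query on wires qs.
   Out-of-range references / unrecognized instructions give false. *)
Definition cstep (x r : seq bool) (A : lang) (ws : seq bool) (l : seq nat) : bool :=
  match l with
  | [:: 0%N; b] => b != 0%N
  | [:: 1%N; i] => nth false x i
  | [:: 2%N; j] => nth false r j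
  | [:: 3%N; i; j] => ~~ (nth false ws i && nth false ws j)
  | 4%N :: qs => A (map (nth false ws) qs)
  | _ => false
  end.

Definition ceval (x r : seq bool) (A : lang) (ins : seq (seq nat)) : seq bool :=
  foldl (fun ws l => rcons ws (cstep x r A ws l)) [::] ins.

(* header [:: R; oa; of]: R random bits, answer wire oa, success-flag wire of *)
Definition ZPP (A : lang) (L : lang) : Prop :=
  exists f, poly_computable f /\
    forall x, exists R oa ofl ins,
      decode (f x) = [:: R; oa; ofl] :: ins /\
      (forall r : R.-tuple bool,
          nth false (ceval x r A ins) ofl -> nth false (ceval x r A ins) oa = L x) /\
      (2 ^ R <= 2 * #|[set r : R.-tuple bool | nth false (ceval x r A ins) ofl]|)%N.

(* Main.v *)
Require Import Defs.
From HB Require Import structures.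
From mathcomp Require Import all_boot all_order all_algebra all_field.
From mathcomp Require Import zify ring.
From Stdlib Require Import FunctionalExtensionality ClassicalEpsilon.
Set Implicit Arguments. Unset Strict Implicit. Unset Printing Implicit Defensive.
Import Order.TTheory GRing.Theory Num.Theory.

(** The oracle encodes, for every n, a function b on n-bit strings that is either
    constantly true or balanced.  The value b(y) is hidden behind random trials r,
    at least half of which succeed: a trial reveals b(y) or fails.  Hence a
    zero-error machine computes b, and the Deutsch-Jozsa algorithm with b as its
    oracle decides exactly whether b is constant.

    An amplitude of a quantum circuit with d queries is a polynomial of degree at
    most d in the oracle bits.  Suppose that an amplitude vanishes for all balanced
    b and all sets of failing trials that leave half of the trials successful.  Then,
    for fixed balanced b, it vanishes on all small sets U of failing trials, hence,
    its degree being small, on all U.  In particular it vanishes whenever at most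
    half of the y have successful trials, all of them revealing true.  As a
    polynomial in the set of these y it has degree at most 2^(n-1), so it vanishes
    identically, and in particular for the constant b.  So an NQP machine errs on
    some b, and one diagonalizes over the countably many circuit families (gates are
    algebraic), choosing the levels n so sparse that they do not interact. *)

(** * Structured programs for single-tape machines *)

(** The obstacle is that a machine need only behave well on oracles that keep both promises, and
    constant and balanced functions differ on half of all points, so no path between them stays
    inside the promises. If [b] could be queried directly, Deutsch-Jozsa would decide the language
    exactly. Failing trials create common ground: a point on which every trial fails is compatible
    with either value. Such oracles violate the zero-error condition, and the polynomial argument
    carries vanishing amplitudes over to them. The threshold 2^(n-1) is the size of a balanced set:
    every set of points up to the degree still fits inside one. The intermediate language also
    answers whether a string is all zero. The circuits can thus ask the oracle for the final test of
    Deutsch-Jozsa, and three fixed gates on one or two qubits suffice. Uniformity demands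
    single-tape machines that print the circuits. As these depend on the input length only, a small
    loop language with one counter is enough, and it is compiled once and for all. *)

Inductive sym := Blank | Bit0 | Bit1 | Sharp | Before | Here | After | Mark.

Definition sym_ord (s : sym) : 'I_8 :=
  match s with
  | Blank => ord0 | Bit0 => @Ordinal 8 1 isT
  | Bit1 => @Ordinal 8 2 isT | Sharp => @Ordinal 8 3 isT
  | Before => @Ordinal 8 4 isT | Here => @Ordinal 8 5 isT
  | After => @Ordinal 8 6 isT | Mark => @Ordinal 8 7 isT
  end.

Definition ord_sym (i : 'I_8) : sym :=
  nth Blank [:: Blank; Bit0; Bit1; Sharp; Before; Here; After; Mark] i.

Lemma sym_ordK : cancel sym_ord ord_sym. Proof. by case. Qed.

Definition tape := (seq sym * sym * seq sym)%type.

Definition tmove (s : sym) (d : bool) (t : tape) : tape :=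
  let: (l, _, r) := t in
  if d then (s :: l, head Blank r, behead r)
  else (behead l, head Blank l, s :: r).

Record mach := Mach {
  mstate : finType;
  mstart : mstate;
  mdelta : mstate -> sym -> option (mstate * sym * bool) }.

Fixpoint mrun (m : mach) (n : nat) (q : mstate m) (t : tape) : option (mstate m * tape) :=
  if n is n'.+1 then
    if mdelta q t.1.2 is Some (q', s, d) then mrun n' q' (tmove s d t) else None
  else Some (q, t).

Lemma mrun_add m a b (q q' : mstate m) t t' :
  mrun a q t = Some (q', t') -> mrun (a + b) q t = mrun b q' t'.
Proof.
elim: a q t => [|a IH] q t /=; first by case=> -> ->.
by case: (mdelta _ _) => [[[q1 s] d]|] //; exact: IH.
Qed.

Lemma mrun_same m n (p q : mstate m) t :
  mdelta p t.1.2 = mdelta q t.1.2 -> mrun n.+1 p t = mrun n.+1 q t.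
Proof. by move=> /= ->. Qed.

Inductive cmd :=
  | Skip
  | Step of (sym -> sym * bool)
  | Seq of cmd & cmd
  | While of (sym -> bool) & cmd
  | If of (sym -> bool) & cmd & cmd.

Definition relabel (S T : Type) (j : S -> T) (x : option (S * sym * bool)) :
    option (T * sym * bool) :=
  if x is Some (q, s, d) then Some (j q, s, d) else None.

(* A machine that halts hands over by performing the first transition of its
   successor, because a transition always moves the head. *)
Fixpoint compile (c : cmd) : mach :=
  match c with
  | Skip => @Mach unit tt (fun _ _ => None)
  | Step g => @Mach bool false
      (fun q s => if q then None else Some (true, (g s).1, (g s).2))
  | Seq c1 c2 =>
      let m1 := compile c1 in let m2 := compile c2 in
      @Mach (mstate m1 + mstate m2)%type (inl (mstart m1))
        (fun q s => match q with
           | inl q1 => if mdelta q1 s is Some x then relabel inl (Some x)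
                       else relabel inr (mdelta (mstart m2) s)
           | inr q2 => relabel inr (mdelta q2 s)
           end)
  | While b c =>
      let m := compile c in
      let again s := if b s then relabel some (mdelta (mstart m) s) else None in
      @Mach (option (mstate m)) None
        (fun q s => match q with
           | None => again s
           | Some q1 => if mdelta q1 s is Some x then relabel some (Some x) else again s
           end)
  | If b c1 c2 =>
      let m1 := compile c1 in let m2 := compile c2 in
      @Mach (option (mstate m1 + mstate m2)) None
        (fun q s => match q with
           | None => if b s then relabel (some \o inl) (mdelta (mstart m1) s)
                     else relabel (some \o inr) (mdelta (mstart m2) s)
           | Some (inl q1) => relabel (some \o inl) (mdelta q1 s)
           | Some (inr q2) => relabel (some \o inr) (mdelta q2 s)
           end)
  end.

(** Tests cost no time: they are folded into the first transition of the command that follows, so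
    the count is the exact number of machine transitions. *)
Inductive exec : cmd -> tape -> nat -> tape -> Prop :=
  | ExSkip t : exec Skip t 0 t
  | ExStep g t : exec (Step g) t 1 (tmove (g t.1.2).1 (g t.1.2).2 t)
  | ExSeq c1 c2 t n1 t1 n2 t2 :
      exec c1 t n1 t1 -> exec c2 t1 n2 t2 -> exec (Seq c1 c2) t (n1 + n2) t2
  | ExStop (b : sym -> bool) c t : ~~ b t.1.2 -> exec (While b c) t 0 t
  | ExLoop (b : sym -> bool) c t n1 t1 n2 t2 : b t.1.2 -> exec c t n1 t1 -> 0 < n1 ->
      exec (While b c) t1 n2 t2 -> exec (While b c) t (n1 + n2) t2
  | ExThen (b : sym -> bool) c1 c2 t n t' : b t.1.2 -> exec c1 t n t' -> exec (If b c1 c2) t n t'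
  | ExElse (b : sym -> bool) c1 c2 t n t' : ~~ b t.1.2 -> exec c2 t n t' -> exec (If b c1 c2) t n t'.

Definition halts_from (m : mach) (q : mstate m) (t : tape) (n : nat) (t' : tape) : Prop :=
  exists2 q', mrun n q t = Some (q', t') & mdelta q' t'.1.2 = None.

Lemma mrun_embed (m M : mach) (j : mstate m -> mstate M) n q q' t t' :
  (forall q s x, mdelta q s = Some x -> mdelta (j q) s = relabel j (Some x)) ->
  mrun n q t = Some (q', t') -> mrun n (j q) t = Some (j q', t').
Proof.
move=> hj; elim: n q t => [|n IH] q t /=; first by case=> -> ->.
case E: (mdelta q _) => [[[q1 s] d]|] //.
by rewrite (hj _ _ _ E) /=; exact: IH.
Qed.

(** A command is entered by performing its first transition from the foreign state [p]. A run of
    zero steps therefore leaves the machine in [p], and only a longer run ends in the image of [j];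
    the final disjunction separates the two. *)
Lemma halts_handoff (m M : mach) (j : mstate m -> mstate M) (q : mstate m) (p : mstate M)
    n t t' :
  (forall q s x, mdelta q s = Some x -> mdelta (j q) s = relabel j (Some x)) ->
  mdelta p t.1.2 = relabel j (mdelta q t.1.2) ->
  halts_from q t n t' ->
  exists q2 p2, [/\ mrun n p t = Some (p2, t'), mdelta q2 t'.1.2 = None
     & p2 = j q2 \/ (p2 = p /\ q2 = q /\ t' = t)].
Proof.
move=> hj hp [q2]; case: n => [|n] /=.
  by case=> <- <- h; exists q, p; split=> //; right.
case E: (mdelta q _) hp => [[[q1 s] d]|] //= -> h1 h2.
exists q2, (j q2); split=> //; last by left.
exact: mrun_embed h1.
Qed.

Lemma exec_compile c t n t' : exec c t n t' -> halts_from (mstart (compile c)) t n t'.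
Proof.
elim=> {c t n t'}.
- by move=> t; exists tt.
- by move=> g t; exists true.
- move=> c1 c2 t n1 t1 n2 t2 _ [q1 r1 h1] _ H2.
  have E1 : mrun n1 (mstart (compile (Seq c1 c2))) t = Some (inl q1, t1).
    apply: (@mrun_embed _ (compile (Seq c1 c2)) inl) r1.
    by move=> q s x /= ->.
  have hp : @mdelta (compile (Seq c1 c2)) (inl q1) t1.1.2
      = relabel inr (mdelta (mstart (compile c2)) t1.1.2) by rewrite /= h1.
  have hj : forall q s x, @mdelta (compile c2) q s = Some x ->
      @mdelta (compile (Seq c1 c2)) (inr q) s = relabel inr (Some x).
    by move=> q s x /= ->.
  have [q2 [p2 [r2 h2 hcase]]] := halts_handoff hj hp H2.
  exists p2; first by rewrite (mrun_add _ E1).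
  case: hcase => [->|[-> [e e']]]; first by rewrite /= h2.
  by rewrite e e' in h2 *; rewrite hp h2.
- by move=> b c t h; exists None => //=; rewrite (negbTE h).
- move=> b c t n1 t1 n2 t2 hb _ H1 n1_gt0 ex2 H2.
  have hj : forall q s x, @mdelta (compile c) q s = Some x ->
      @mdelta (compile (While b c)) (Some q) s = relabel some (Some x).
    by move=> q s x /= ->.
  have hp : @mdelta (compile (While b c)) None t.1.2
      = relabel some (mdelta (mstart (compile c)) t.1.2) by rewrite /= hb.
  have [q1 [p1 [r1 h1 hc1]]] := halts_handoff hj hp H1.
  (* the halted body behaves exactly as the test state *)
  have hp1 : @mdelta (compile (While b c)) p1 t1.1.2
     = @mdelta (compile (While b c)) None t1.1.2.
    by case: hc1 => [->|[-> _]] //=; rewrite h1.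
  case: H2 => q2 r2 h2.
  case: n2 ex2 r2 => [|n2] ex2 /=.
    case=> e2 e3; subst q2 t2; exists p1; first by rewrite addn0.
    by rewrite hp1.
  move=> r2; exists q2 => //; rewrite (mrun_add _ r1).
  exact: etrans (mrun_same n2 hp1) r2.
- move=> b c1 c2 t n t' hb _ H.
  have hj : forall q s x, @mdelta (compile c1) q s = Some x ->
      @mdelta (compile (If b c1 c2)) (Some (inl q)) s = relabel (some \o inl) (Some x).
    by move=> q s x /= ->.
  have hp : @mdelta (compile (If b c1 c2)) None t.1.2
      = relabel (some \o inl) (mdelta (mstart (compile c1)) t.1.2) by rewrite /= hb.
  have [q1 [p1 [r1 h1 hc1]]] := halts_handoff hj hp H.
  exists p1 => //; case: hc1 => [->|[-> [e e']]]; first by rewrite /= h1.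
  by rewrite e e' in h1 *; rewrite hp h1.
- move=> b c1 c2 t n t' hb _ H.
  have hj : forall q s x, @mdelta (compile c2) q s = Some x ->
      @mdelta (compile (If b c1 c2)) (Some (inr q)) s = relabel (some \o inr) (Some x).
    by move=> q s x /= ->.
  have hp : @mdelta (compile (If b c1 c2)) None t.1.2
      = relabel (some \o inr) (mdelta (mstart (compile c2)) t.1.2).
    by rewrite /= (negbTE hb).
  have [q1 [p1 [r1 h1 hc1]]] := halts_handoff hj hp H.
  exists p1 => //; case: hc1 => [->|[-> [e e']]]; first by rewrite /= h1.
  by rewrite e e' in h1 *; rewrite hp h1.
Qed.

HB.instance Definition _ := Equality.copy sym (can_type sym_ordK).

Section Embedding.
Variable m : mach.

(** A [TM] starts in state 0, so the start state is sent there and all other states are shifted past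
    it. *)
Definition state_ord (q : mstate m) : 'I_#|mstate m|.+1 :=
  if q == mstart m then ord0 else lift ord0 (enum_rank q).

Definition ord_state (i : 'I_#|mstate m|.+1) : mstate m :=
  if unlift ord0 i is Some k then enum_val k else mstart m.

Lemma state_ordK : cancel state_ord ord_state.
Proof.
move=> q; rewrite /state_ord /ord_state; case: eqVneq => [->|_].
  by rewrite unlift_none.
by rewrite liftK enum_rankK.
Qed.

Definition tm_of : TM := @MkTM #|mstate m| 5
  (fun q s => if mdelta (ord_state q) (ord_sym s) is Some (q', s', d)
              then Some (state_ord q', sym_ord s', d) else None).

Definition config_of (q : mstate m) (t : tape) : config tm_of :=
  @Config tm_of (state_ord q) (map sym_ord t.1.1) (sym_ord t.1.2) (map sym_ord t.2).

Lemma tm_step_config q t : tm_step (config_of q t) =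
  if mdelta q t.1.2 is Some (q', s, d) then Some (config_of q' (tmove s d t)) else None.
Proof.
rewrite /tm_step /= state_ordK sym_ordK; case: (mdelta _ _) => [[[q' s] d]|] //.
by case: d; case: t => [[[|y l] c] [|z r]].
Qed.

(** [tm_run] spends one more unit of fuel to notice that no transition applies, hence [N.+1]. *)
Lemma tm_run_halt n q t q' t' N : mrun n q t = Some (q', t') ->
  mdelta q' t'.1.2 = None -> n <= N -> tm_run N.+1 (config_of q t) = Some (config_of q' t').
Proof.
move=> + h; elim: n q t N => [|n IH] q t N.
  by case=> -> -> _; rewrite /tm_run tm_step_config h.
rewrite [mrun _ _ _]/= [tm_run _ _]/=; case: N => [|N] //; rewrite tm_step_config.
case: (mdelta _ _) => [[[q1 s] d]|] // run le_nN. exact: IH run le_nN.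
Qed.

End Embedding.

Definition bit (b : bool) : sym := if b then Bit1 else Bit0.

Fixpoint read (s : seq sym) : seq bool :=
  match s with
  | Bit0 :: s' => false :: read s'
  | Bit1 :: s' => true :: read s'
  | _ => [::]
  end.

Lemma read_bits_map s : read_bits (map sym_ord s) = read s.
Proof. by elim: s => [|[] s IH] //=; rewrite IH. Qed.

(* The head scans the first symbol of r (a blank if r is empty). *)
Definition at_ (l r : seq sym) : tape := (l, head Blank r, behead r).

Lemma exec_poly_computable (f : seq bool -> seq bool) c k :
  (forall x, exists n t, [/\ exec c (at_ [::] (map bit x)) n t,
     n <= size x ^ k + k & read (t.1.2 :: t.2) = f x]) -> poly_computable f.
Proof.
move=> H; exists (tm_of (compile c)), k => x.
have [n [t [/exec_compile [q run halt] le_n <-]]] := H x.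
exists (config_of q t); split.
  rewrite -(tm_run_halt run halt le_n); congr (tm_run _ _).
  rewrite /init_config /config_of /state_ord eqxx.
  have E : map (sym_of_bit (tm_of (compile c))) x = map sym_ord (map bit x).
    rewrite -map_comp; apply: eq_map => b; apply: val_inj.
    by rewrite /= /sym_of_bit; case: b; rewrite /= inordK.
  by rewrite E; case: x {H E run le_n} => [|b x] //=; congr Config; apply: val_inj.
exact: read_bits_map (t.1.2 :: t.2).
Qed.

(** * Time bounds and head sweeps *)

Lemma tmove_right s l r : tmove s true (at_ l r) = at_ (s :: l) (behead r).
Proof. by []. Qed.

Lemma tmove_left s x l r : tmove s false (at_ (x :: l) r) = at_ l (x :: s :: behead r).
Proof. by []. Qed.

Definition runs c t N t' := exists2 n, exec c t n t' & n <= N.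
(** A loop body must take at least one step in [exec], so positivity is carried along with the
    bound. *)
Definition runs_pos c t N t' := exists2 n, exec c t n t' & 0 < n <= N.

Lemma runsW c t N t' : runs_pos c t N t' -> runs c t N t'.
Proof. by case=> n ? /andP[_ ?]; exists n. Qed.

Lemma runs_le c t N N' t' : runs c t N t' -> N <= N' -> runs c t N' t'.
Proof. by case=> n ? h h'; exists n => //; apply: leq_trans h'. Qed.

Lemma runs_step g t : runs_pos (Step g) t 1 (tmove (g t.1.2).1 (g t.1.2).2 t).
Proof. by exists 1 => //; exact: ExStep. Qed.

Lemma runs_seq c1 c2 t N1 t1 N2 t2 :
  runs c1 t N1 t1 -> runs c2 t1 N2 t2 -> runs (Seq c1 c2) t (N1 + N2) t2.
Proof. by case=> a ? ? [b ? ?]; exists (a + b); [apply: ExSeq; eassumption | lia]. Qed.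

Lemma runs_seq_pos c1 c2 t N1 t1 N2 t2 :
  runs_pos c1 t N1 t1 -> runs c2 t1 N2 t2 -> runs_pos (Seq c1 c2) t (N1 + N2) t2.
Proof. by case=> a ? ? [b ? ?]; exists (a + b); [apply: ExSeq; eassumption | lia]. Qed.

Lemma runs_stop (b : sym -> bool) c t : ~~ b t.1.2 -> runs (While b c) t 0 t.
Proof. by exists 0 => //; exact: ExStop. Qed.

Lemma runs_loop (b : sym -> bool) c t N1 t1 N2 t2 : b t.1.2 -> runs_pos c t N1 t1 ->
  runs (While b c) t1 N2 t2 -> runs (While b c) t (N1 + N2) t2.
Proof.
move=> hb [x ? /andP[? ?]] [y ? ?]; exists (x + y); last lia.
by apply: ExLoop; eassumption.
Qed.

Lemma sweep_right (b : sym -> bool) (g : sym -> sym) l u r : all b u -> ~~ b (head Blank r) ->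
  runs (While b (Step (fun s => (g s, true)))) (at_ l (u ++ r)) (size u)
       (at_ (rev (map g u) ++ l) r).
Proof.
move=> + hr; elim: u l => [|x u IH] l /=; first by move=> _; exact: runs_stop.
case/andP=> hx hu; rewrite -add1n; apply: runs_loop => //.
  exact: (@runs_step (fun s => (g s, true)) (at_ l (x :: u ++ r))).
by rewrite tmove_right /= rev_cons cat_rcons; exact: IH.
Qed.

Lemma sweep_left (b : sym -> bool) (g : sym -> sym) l u x y r :
  b y -> all b u -> ~~ b x ->
  runs (While b (Step (fun s => (g s, false)))) (at_ (u ++ x :: l) (y :: r)) (size u).+1
       (at_ l (x :: rev (map g (y :: u)) ++ r)).
Proof.
move=> + + hx; elim: u y r => [|z u IH] y r hy /= hu; rewrite -add1n.
  apply: runs_loop (runs_stop _ _) => //.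
  exact: (@runs_step (fun s => (g s, false)) (at_ (x :: l) (y :: r))).
case/andP: hu => hz hu; apply: runs_loop => //.
  exact: (@runs_step (fun s => (g s, false)) (at_ (z :: u ++ x :: l) (y :: r))).
rewrite tmove_left /= [rev (_ :: _ :: _)]rev_cons cat_rcons.
exact: (IH z (g y :: r)).
Qed.

Definition put (s : sym) : cmd := Step (fun _ => (s, true)).

Lemma runs_put s l x r : runs_pos (put s) (at_ l (x :: r)) 1 (at_ (s :: l) r).
Proof. exact: (@runs_step (fun _ => (s, true)) (at_ l (x :: r))). Qed.

Definition write (w : seq bool) : cmd :=
  foldr (fun b c => Seq (put (bit b)) c) Skip w.

Lemma runs_write w l : runs (write w) (at_ l [:: Blank]) (size w)
  (at_ (rev (map bit w) ++ l) [:: Blank]).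
Proof.
elim: w l => [|b w IH] l /=; first by exists 0 => //; exact: ExSkip.
rewrite -add1n; apply: runs_seq; first exact/runsW/runs_put.
by rewrite rev_cons cat_rcons; exact: IH.
Qed.

(* The mark m is left on the starting cell so that the head can find its way back. *)
Definition emit (m : sym) (w : seq bool) : cmd :=
  Seq (put m) (Seq (While (fun s => s != Blank) (Step (fun s => (s, true))))
    (Seq (write w) (While (fun s => s != m) (Step (fun s => (s, false)))))).

Lemma runs_emit (m x : sym) (mid : seq sym) w l out K :
  (m == Mark) || (m == Sharp) -> all (fun s => (s != Blank) && (s != m)) mid ->
  size mid + size out + size w <= K ->
  runs_pos (emit m w) (at_ l (x :: mid ++ map bit out ++ [:: Blank])) (2 * K + 2)
    (at_ l (m :: mid ++ map bit (out ++ w) ++ [:: Blank])).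
Proof.
move=> hm hmid hK.
have hmidB : all (fun s => s != Blank) mid by apply: sub_all hmid => s /andP[].
have hmidM : all (fun s => s != m) mid by apply: sub_all hmid => s /andP[].
have hB o : all (fun s => s != Blank) (map bit o) by elim: o => [|[] o].
have hM o : all (fun s => s != m) (map bit o).
  by elim: o => [|[] o] //= ->; case/orP: hm => /eqP ->.
have [n ex le_n] : runs_pos (emit m w) (at_ l (x :: mid ++ map bit out ++ [:: Blank]))
   (1 + (size (mid ++ map bit out) + (size w + (size (rev (map bit w) ++ rev (mid ++ map bit out))).+1)))
    (at_ l (m :: mid ++ map bit (out ++ w) ++ [:: Blank])).
  apply: runs_seq_pos; first exact: runs_put.
  apply: runs_seq.
    rewrite catA; apply: (sweep_right id) => //.
    by rewrite all_cat hmidB hB.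
  rewrite map_id; apply: runs_seq; first exact: runs_write.
  rewrite [rev (map bit w) ++ _ ++ _]catA.
  have -> : m :: mid ++ map bit (out ++ w) ++ [:: Blank] =
     m :: rev (map id (Blank :: rev (map bit w) ++ rev (mid ++ map bit out))) ++ [::].
    by rewrite map_id rev_cons rev_cat !revK cats0 map_cat -cats1 -!catA.
  apply: (@sweep_left (fun s => s != m) id) => /=.
  - by case/orP: hm => /eqP ->.
  - by rewrite all_cat !all_rev all_cat hmidM !hM.
  - by rewrite eqxx.
exists n => //; move: le_n; rewrite !size_cat !size_rev !size_cat !size_map. lia.
Qed.

(** * A loop language for strings that depend only on the input length *)

Definition rep (i : nat) (e : seq bool) := flatten (nseq i e).

Inductive item :=
  | Const of seq bool
  | Loop of seq bool & seq bool & seq bool & seq bool.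

Definition loop_body (b e e' d : seq bool) (n i : nat) : seq bool :=
  b ++ rep i e ++ rep (n - i) e' ++ d.

Definition item_out (n : nat) (it : item) : seq bool :=
  match it with
  | Const w => w
  | Loop b e e' d => flatten [seq loop_body b e e' d n i | i <- iota 0 n]
  end.

Definition prog_out (n : nat) (p : seq item) : seq bool :=
  flatten (map (item_out n) p).

(** The tape holds a blank, n cells, a [Sharp] and then the output. The cells are the loop counter:
    in round i the first i are [Before], the next is [Here], the rest are [After]. *)
Definition cell (s : sym) : bool := [|| s == Before, s == Here | s == After].

Definition emit_at (s : sym) (w : seq bool) : cmd := Seq (emit Mark w) (put s).

Definition pass (e e' : seq bool) : cmd :=
  While (fun s => s != Sharp)
    (If (fun s => s == Before) (emit_at Before e)
      (If (fun s => s == Here) (emit_at Here e') (emit_at After e'))).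

(** The current cell counts with those after it, which yields the i and n - i copies of
    [loop_body]. *)
Definition cell_word (e e' : seq bool) (s : sym) := if s == Before then e else e'.

Lemma runs_emit_at (s : sym) w l mid out K :
  all cell mid -> size mid + size out + size w <= K ->
  runs_pos (emit_at s w) (at_ l (s :: mid ++ Sharp :: map bit out ++ [:: Blank])) (2 * K + 5)
    (at_ (s :: l) (mid ++ Sharp :: map bit (out ++ w) ++ [:: Blank])).
Proof.
move=> hmid hK.
have -> : 2 * K + 5 = (2 * K.+1 + 2) + 1 by lia.
rewrite -!(cat_rcons Sharp mid).
apply: (@runs_seq_pos _ _ _ _ (at_ l (Mark :: rcons mid Sharp ++ map bit (out ++ w) ++ [:: Blank])));
  last exact/runsW/runs_put.
apply: runs_emit => //.
  by rewrite all_rcons /=; apply: sub_all hmid => -[].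
by rewrite size_rcons; lia.
Qed.

Lemma runs_pass e e' cs l out K : all cell cs ->
  size cs + size out + size (flatten (map (cell_word e e') cs)) <= K ->
  runs (pass e e') (at_ l (cs ++ Sharp :: map bit out ++ [:: Blank]))
    (size cs * (2 * K + 5))
    (at_ (rev cs ++ l)
      (Sharp :: map bit (out ++ flatten (map (cell_word e e') cs)) ++ [:: Blank])).
Proof.
elim: cs l out => [|s cs IH] l out.
  by move=> _ _; rewrite /= cats0; exact: runs_stop.
rewrite [all _ _]/= [size (s :: _)]/= [flatten _]/= size_cat => /andP[hs hcs] hK.
rewrite mulSn rev_cons cat_rcons [out ++ _]catA.
apply: (@runs_loop _ _ _ _
   (at_ (s :: l) (cs ++ Sharp :: map bit (out ++ cell_word e e' s) ++ [:: Blank]))).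
- by case: s hs {hK}.
- have hE : runs_pos (emit_at s (cell_word e e' s))
      (at_ l (s :: cs ++ Sharp :: map bit out ++ [:: Blank])) (2 * K + 5)
      (at_ (s :: l) (cs ++ Sharp :: map bit (out ++ cell_word e e' s) ++ [:: Blank])).
    by apply: runs_emit_at => //; lia.
  case: hE => n ex le_n; exists n => //.
  case: s hs ex {hK le_n } => // _ ex.
  + exact: ExThen.
  + by apply: ExElse => //; apply: ExThen.
  + by apply: ExElse => //; apply: ExElse.
- by apply: IH => //; rewrite size_cat; lia.
Qed.

Definition right_to (s : sym) := While (fun s' => s' != s) (Step (fun s' => (s', true))).
Definition left_to (s : sym) := While (fun s' => s' != s) (Step (fun s' => (s', false))).
Definition go_right := Step (fun s => (s, true)).

Definition outer (b e e' d : seq bool) : cmd :=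
  While (fun s => s != Sharp)
   (Seq (put Here) (Seq (right_to Sharp) (Seq (emit Sharp b) (Seq (left_to Blank)
     (Seq go_right (Seq (pass e e') (Seq (emit Sharp d)
       (Seq (left_to Here) (put Before))))))))).

Definition item_cmd (it : item) : cmd :=
  match it with
  | Const w => emit Sharp w
  | Loop b e e' d =>
      Seq (While (fun s => s != Blank)
        (Step (fun s => (if s == Sharp then Sharp else After, false))))
       (Seq go_right (outer b e e' d))
  end.

(** A pass visits at most K cells at 2K + 5 steps each; the slack covers the two other [emit]s and
    the sweeps. *)
Definition body_time K := (K + 2) * (2 * K + 20).

Lemma flatten_cell_word e e' i j :
  flatten (map (cell_word e e') (nseq i Before ++ Here :: nseq j After)) =
  rep i e ++ rep j.+1 e'.
Proof. by rewrite map_cat flatten_cat /= !map_nseq. Qed.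

(** Here i rounds are done and j remain. The counter width i + j stays fixed while the induction
    moves one unit from j to i. *)
Lemma runs_outer b e e' d i j out K :
  i + j + size out +
    size (flatten [seq loop_body b e e' d (i + j) k | k <- iota i j]) <= K ->
  runs (outer b e e' d)
    (at_ (nseq i Before ++ [:: Blank]) (nseq j After ++ Sharp :: map bit out ++ [:: Blank]))
    (j * body_time K)
    (at_ (nseq (i + j) Before ++ [:: Blank])
      (Sharp :: map bit (out ++ flatten [seq loop_body b e e' d (i + j) k | k <- iota i j])
         ++ [:: Blank])).
Proof.
elim: j i out => [|j IH] i out.
  by move=> _; rewrite addn0 /= cats0; exact: runs_stop.
rewrite [iota _ _]/= [map _ (_ :: _)]/= [flatten _]/= size_cat => hK.
rewrite mulSn [out ++ _]catA.
set w := loop_body _ _ _ _ _ i in hK *.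
have wE : w = b ++ flatten (map (cell_word e e') (nseq i Before ++ Here :: nseq j After)) ++ d.
  by rewrite flatten_cell_word -catA /w /loop_body; congr (_ ++ (_ ++ (rep _ _ ++ _))); lia.
apply: (@runs_loop _ _ _ _ (at_ (nseq i.+1 Before ++ [:: Blank])
    (nseq j After ++ Sharp :: map bit (out ++ w) ++ [:: Blank]))) => //; last first.
  rewrite -addSnnS in hK *; apply: IH; move: hK; rewrite size_cat; lia.
set cs := nseq i Before ++ Here :: nseq j After.
have hcs : all cell cs by rewrite all_cat /= !all_nseq /= !orbT.
have size_cs : size cs = i + j.+1 by rewrite size_cat /= !size_nseq.
have wsize : size w = size b + size (flatten (map (cell_word e e') cs)) + size d.
  by rewrite wE !size_cat addnA.
have rcs : rev cs = nseq j After ++ Here :: nseq i Before.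
  by rewrite rev_cat rev_cons !rev_nseq cat_rcons.
have [n ex le_n] : runs_pos (Seq (put Here) (Seq (right_to Sharp) (Seq (emit Sharp b)
   (Seq (left_to Blank) (Seq go_right (Seq (pass e e') (Seq (emit Sharp d)
       (Seq (left_to Here) (put Before)))))))))
   (at_ (nseq i Before ++ [:: Blank]) (nseq j.+1 After ++ Sharp :: map bit out ++ [:: Blank]))
   (1 + (j + ((2 * K + 2) + ((i + j.+1).+1 + (1 + ((i + j.+1) * (2 * K + 5) +
      ((2 * K + 2) + (j.+1 + 1))))))))
   (at_ (nseq i.+1 Before ++ [:: Blank])
    (nseq j After ++ Sharp :: map bit (out ++ w) ++ [:: Blank])).
  apply: runs_seq_pos; first exact: runs_put.
  apply: runs_seq.
    have := @sweep_right (fun s => s != Sharp) id (Here :: nseq i Before ++ [:: Blank])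
      (nseq j After) (Sharp :: map bit out ++ [:: Blank]).
    by rewrite size_nseq map_id rev_nseq; apply => //; rewrite all_nseq orbT.
  apply: runs_seq.
    by apply/runsW; apply: (@runs_emit _ _ [::]) => //=; lia.
  apply: runs_seq.
    have := @sweep_left (fun s => s != Blank) id [::] (rev cs) Blank Sharp
      (map bit (out ++ b) ++ [:: Blank]).
    rewrite size_rev size_cs rcs -catA /=; apply => //.
    by rewrite all_cat /= !all_nseq /= !orbT.
  rewrite map_id rev_cons -rcs revK cat_rcons.
  apply: runs_seq; first exact/runsW/runs_step.
  rewrite tmove_right /=.
  apply: runs_seq.
    by rewrite -size_cs; apply: runs_pass => //; rewrite size_cs size_cat; lia.
  apply: runs_seq.
    by apply/runsW; apply: (@runs_emit _ _ [::]) => //=; rewrite !size_cat; lia.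
  rewrite -!catA -wE rcs -catA.
  apply: runs_seq.
    have := @sweep_left (fun s => s != Here) id (nseq i Before ++ [:: Blank]) (nseq j After)
      Here Sharp (map bit (out ++ w) ++ [:: Blank]).
    rewrite size_nseq map_id rev_cons rev_nseq cat_rcons; apply => //.
    by rewrite all_nseq /= orbT.
  exact/runsW/runs_put.
exists n => //; move: le_n; rewrite /body_time; nia.
Qed.

Definition item_time K := (K + 2) * body_time K.

Lemma runs_item it n out K cs : all cell cs -> size cs = n ->
  n + size out + size (item_out n it) <= K ->
  exists2 cs', all cell cs' /\ size cs' = n &
  runs (item_cmd it)
    (at_ (cs ++ [:: Blank]) (Sharp :: map bit out ++ [:: Blank])) (item_time K)
    (at_ (cs' ++ [:: Blank]) (Sharp :: map bit (out ++ item_out n it) ++ [:: Blank])).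
Proof.
move=> hcs szcs; case: it => [w|b e e' d] /= hK.
  exists cs => //; apply/runsW.
  have [m ? ?] := @runs_emit Sharp Sharp [::] w (cs ++ [:: Blank]) out K isT isT
    ltac:(move: hK => /=; lia).
  by exists m => //; rewrite /item_time /body_time; nia.
exists (nseq n Before); first by rewrite all_nseq orbT size_nseq.
have hO := @runs_outer b e e' d 0 n out K hK.
set g := fun s => if s == Sharp then Sharp else After.
have hg : map g (rev cs) = nseq n After.
  rewrite -szcs -size_rev; have : all cell (rev cs) by rewrite all_rev.
  by elim: (rev cs) => [|s r IH] //= /andP[hs /IH ->]; case: s hs.
apply: (@runs_le _ _ (n.+1 + (1 + n * body_time K))); last first.
  by rewrite /item_time /body_time; nia.
apply: runs_seq.
  have := @sweep_left (fun s => s != Blank) g [::] cs Blank Sharp (map bit out ++ [:: Blank]).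
  rewrite szcs; apply => //; apply: sub_all hcs => -[] //.
rewrite [map g _]/= rev_cons -map_rev hg cat_rcons.
apply: runs_seq; first exact/runsW/runs_step.
exact: hO.
Qed.

Definition prog_cmd (p : seq item) : cmd := foldr (fun it c => Seq (item_cmd it) c) go_right p.

Lemma runs_prog p n out K cs : all cell cs -> size cs = n ->
  n + size out + size (prog_out n p) <= K ->
  exists l,
  runs (prog_cmd p)
    (at_ (cs ++ [:: Blank]) (Sharp :: map bit out ++ [:: Blank])) (size p * item_time K + 1)
    (at_ l (map bit (out ++ prog_out n p) ++ [:: Blank])).
Proof.
elim: p out cs => [|it p IH] out cs hcs szcs hK.
  by exists (Sharp :: cs ++ [:: Blank]); rewrite cats0; exact/runsW/runs_step.
have hK' : n + (size out + size (item_out n it) + size (prog_out n p)) <= K.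
  by move: hK; rewrite /prog_out /= size_cat; lia.
have [|cs' [hcs' szcs'] run1] := @runs_item it n out K cs hcs szcs; first lia.
have [|l run2] := IH (out ++ item_out n it) cs' hcs' szcs'.
  by rewrite size_cat; lia.
exists l; rewrite mulSn -addnA; apply: runs_seq; first exact: run1.
by move: run2; rewrite /prog_out /= -catA.
Qed.

(** The step left and back creates an explicit blank before the input, where later leftward sweeps
    stop. The last [go_right] of [prog_cmd] leaves the head on the first output bit, where a [TM]
    output is read. *)
Definition full_cmd (p : seq item) : cmd :=
  Seq (Step (fun s => (s, false))) (Seq go_right
   (Seq (While (fun s => s != Blank) (put After))
    (Seq (put Sharp) (Seq (Step (fun s => (s, false))) (prog_cmd p))))).

Lemma runs_full p x K : size x + size (prog_out (size x) p) <= K -> exists l,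
  runs (full_cmd p) (at_ [::] (map bit x)) (K + 5 + size p * item_time K)
    (at_ l (map bit (prog_out (size x) p) ++ [:: Blank])).
Proof.
move=> hK.
have [|||l run] := @runs_prog p (size x) [::] K (nseq (size x) After).
- by rewrite all_nseq orbT.
- by rewrite size_nseq.
- by move: hK => /=; lia.
exists l.
apply: (@runs_le _ _ (1 + (1 + (size x + (1 + (1 + (size p * item_time K + 1))))))); last lia.
apply: runs_seq; first exact/runsW/runs_step.
apply: runs_seq; first exact/runsW/runs_step.
have -> : tmove ((fun s => (s, true)) (tmove ((fun s => (s, false)) (at_ [::] (map bit x)).1.2).1
  false (at_ [::] (map bit x))).1.2).1 true
  (tmove ((fun s => (s, false)) (at_ [::] (map bit x)).1.2).1 false (at_ [::] (map bit x)))
  = at_ [:: Blank] (map bit x ++ [::]).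
  by case: (x) => [|b y] //=; rewrite cats0.
apply: runs_seq.
  have := @sweep_right (fun s => s != Blank) (fun=> After) [:: Blank] (map bit x) [::].
  rewrite size_map; apply => //; by elim: (x) => //= -[] s.
have -> : map (fun=> After) (map bit x) = nseq (size x) After.
  by elim: (x) => //= b s ->.
rewrite rev_nseq.
apply: runs_seq; first exact: (@runsW _ _ _ _ (@runs_put Sharp _ Blank [::])).
apply: runs_seq; first exact/runsW/runs_step.
exact: run.
Qed.

(** * Circuit descriptions computed by Turing machines *)

(** The base n + 2 is at least 2, so raising the exponent absorbs constants and sums even at n = 0
    and n = 1. *)
Definition poly_bounded (f : nat -> nat) := exists k, forall n, f n <= n.+2 ^ k.

Lemma poly_bounded_le f g : (forall n, f n <= g n) -> poly_bounded g -> poly_bounded f.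
Proof. by move=> h [k hk]; exists k => n; apply: leq_trans (hk n). Qed.

Lemma poly_bounded_const c : poly_bounded (fun=> c).
Proof.
exists c => n; apply: ltnW; apply: leq_trans (ltn_expl c (ltnSn 1)) _.
by case: c => // c; rewrite leq_exp2r.
Qed.

Lemma poly_bounded_id : poly_bounded id.
Proof. by exists 1 => n; rewrite expn1; lia. Qed.

Lemma poly_bounded_add f g : poly_bounded f -> poly_bounded g ->
  poly_bounded (fun n => f n + g n).
Proof.
move=> [k hk] [l hl]; exists (k + l).+1 => n.
rewrite expnS; apply: (@leq_trans (2 * n.+2 ^ (k + l))); last by rewrite leq_mul2r ltnS orbT.
rewrite mul2n -addnn; apply: leq_add.
  by apply: leq_trans (hk n) _; rewrite leq_pexp2l // leq_addr.
by apply: leq_trans (hl n) _; rewrite leq_pexp2l // leq_addl.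
Qed.

Lemma poly_bounded_mul f g : poly_bounded f -> poly_bounded g ->
  poly_bounded (fun n => f n * g n).
Proof. by move=> [k hk] [l hl]; exists (k + l) => n; rewrite expnD leq_mul. Qed.

Lemma poly_bounded_exp k : poly_bounded (fun n => n ^ k).
Proof. by exists k => n; case: k => // k; rewrite leq_exp2r //; lia. Qed.

Lemma poly_bounded_expD f : poly_bounded f -> exists k, forall n, f n <= n ^ k + k.
Proof.
(* For n < 2 the constant 3^k suffices, and otherwise n + 2 <= n^2. *)
move=> [k hk]; exists (2 * k + 3 ^ k) => n; apply: leq_trans (hk n) _.
case: (ltnP n 2) => hn.
  apply: leq_trans (leq_addl _ _); apply: leq_trans (leq_addl _ _).
  by case: (k) => // l; rewrite leq_exp2r //; lia.
apply: leq_trans (leq_addr _ _).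
apply: (@leq_trans (n ^ (2 * k))); last by rewrite leq_pexp2l ?leq_addr //; lia.
rewrite expnM; case: (k) => // l; rewrite leq_exp2r // expnS expn1; nia.
Qed.

Lemma size_rep i e : size (rep i e) = i * size e.
Proof. by rewrite /rep; elim: i => //= i IH; rewrite size_cat IH mulSn. Qed.

Definition item_size (it : item) : nat :=
  match it with
  | Const w => size w
  | Loop b e e' d => size b + size e + size e' + size d
  end.

Lemma size_item_out it n : size (item_out n it) <= item_size it * n.+1 ^ 2.
Proof.
case: it => [w|b e e' d] /=; first by rewrite expnS expn1; nia.
set s := iota 0 n; have ss : size s = n by rewrite size_iota.
have : {in s, forall i, i < n} by move=> i; rewrite mem_iota.
have : size (flatten [seq loop_body b e e' d n i | i <- s]) <=
    size s * ((size b + size e + size e' + size d) * n.+1).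
  have : {in s, forall i, i < n} by move=> i; rewrite mem_iota.
  elim: s {ss} => //= i s IH hs; rewrite size_cat mulSn leq_add //.
    have := hs i (mem_head _ _); rewrite /loop_body !size_cat !size_rep; nia.
  by apply: IH => j js; apply: hs; rewrite inE js orbT.
by rewrite ss expnS expn1; nia.
Qed.

Lemma prog_out_poly p : poly_bounded (fun n => size (prog_out n p)).
Proof.
exists (2 + sumn (map item_size p)) => n.
have h : size (prog_out n p) <= sumn (map item_size p) * n.+1 ^ 2.
  elim: p => //= it p IH; rewrite /prog_out /= size_cat mulnDl leq_add //.
  exact: size_item_out.
apply: leq_trans h _; rewrite expnD mulnC; apply: leq_mul; first by rewrite leq_exp2r.
apply: ltnW; apply: leq_trans (ltn_expl _ (ltnSn 1)) _.
by case: sumn => // c; rewrite leq_exp2r.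
Qed.

Lemma prog_poly_computable p : poly_computable (fun x => prog_out (size x) p).
Proof.
pose K n := n + size (prog_out n p).
have [k hk] : exists k, forall n, K n + 5 + size p * item_time (K n) <= n ^ k + k.
  have hK := poly_bounded_add poly_bounded_id (prog_out_poly p).
  apply: poly_bounded_expD.
  by rewrite /item_time /body_time; do ![exact: hK | exact: poly_bounded_const
    | apply: poly_bounded_add | apply: poly_bounded_mul].
apply: (@exec_poly_computable _ (full_cmd p) k) => x.
have [l [n ex le_n]] := @runs_full p x (K (size x)) (leqnn _).
exists n, (at_ l (map bit (prog_out (size x) p) ++ [:: Blank])); split=> //.
  exact: leq_trans (hk _).
have R s : read (map bit s ++ [:: Blank]) = s by elim: s => //= -[] s /= ->.
by case: (prog_out _ _) => [|b s] //; exact: R (b :: s).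
Qed.

(** * Bit encoding of circuit descriptions *)

Definition unary (k : nat) : seq bool := nseq k.+1 true ++ [:: false].
Definition unaries (l : seq nat) : seq bool := flatten (map unary l).
Definition lines (ls : seq (seq nat)) : seq bool := flatten [seq false :: unaries l | l <- ls].

Lemma blocks_nseq k s acc : blocks (nseq k true ++ s) acc = blocks s (k + acc).
Proof. by elim: k acc => //= k IH acc; rewrite IH addnS. Qed.

Lemma blocks_unaries l s : blocks (unaries l ++ s) 0 = map succn l ++ blocks s 0.
Proof.
elim: l => //= k l IH; rewrite -catA /unary /= -catA blocks_nseq /= addn1.
by rewrite -/(unaries l) IH.
Qed.

Lemma group_blocks_succ l L cur :
  group_blocks (map succn l ++ L) cur = group_blocks L (rev l ++ cur).
Proof. by elim: l cur => //= k l IH cur; rewrite IH rev_cons cat_rcons. Qed.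

Lemma decode_lines l ls : decode (unaries l ++ lines ls) = l :: ls.
Proof.
rewrite /decode; elim: ls l => [|l' ls IH] l.
  by rewrite blocks_unaries group_blocks_succ /= !cats0 revK.
rewrite /lines /= -/(lines ls) blocks_unaries group_blocks_succ /= -/(unaries l').
by rewrite IH cats0 revK.
Qed.

Lemma unaries_cat l l' : unaries (l ++ l') = unaries l ++ unaries l'.
Proof. by rewrite /unaries map_cat flatten_cat. Qed.

Lemma lines_cat ls ls' : lines (ls ++ ls') = lines ls ++ lines ls'.
Proof. by rewrite /lines map_cat flatten_cat. Qed.

Lemma prog_out_cat n p q : prog_out n (p ++ q) = prog_out n p ++ prog_out n q.
Proof. by rewrite /prog_out map_cat flatten_cat. Qed.

Lemma prog_out_cons n it p : prog_out n (it :: p) = item_out n it ++ prog_out n p.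
Proof. by []. Qed.

Lemma rep_nseq i c : rep i (nseq c true) = nseq (c * i) true.
Proof.
rewrite /rep; elim: i => [|i IH]; first by rewrite muln0.
by rewrite /= IH -nseqD mulnS.
Qed.

Definition num (c s : nat) : seq item :=
  [:: Loop (nseq c true) [::] [::] [::]; Const (unary s)].

(** Round i prints (c + 1) i + c (n - i) = c n + i ones before [unary s], hence the numeral of c n +
    s + i. This is why a loop has two repeated words. *)
Definition range (pre : seq bool) (c s : nat) : item :=
  Loop pre (nseq c.+1 true) (nseq c true) (unary s).

Lemma prog_num n c s : prog_out n (num c s) = unary (c * n + s).
Proof.
rewrite /prog_out /= cats0 /loop_body /unary.
have H l : flatten [seq nseq c true ++ rep i [::] ++ rep (n - i) [::] ++ [::] | i <- l] =
    nseq (c * size l) true.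
  elim: l => [|i l IH]; first by rewrite muln0.
  rewrite [LHS]/= {}IH cats0 -[rep i _]/(rep i (nseq 0 true)).
  by rewrite -[rep (n - i) _]/(rep (n - i) (nseq 0 true)) !rep_nseq cats0 -nseqD mulnS.
rewrite H size_iota -addnS nseqD -catA; reflexivity.
Qed.

Lemma item_range n pre c s :
  item_out n (range pre c s) = flatten [seq pre ++ unary k | k <- iota (c * n + s) n].
Proof.
rewrite -[in iota (c * n + s) _](addn0 (c * n + s)) iotaDl -map_comp.
congr flatten; apply/eq_in_map => i; rewrite mem_iota => /andP[_ hi].
rewrite /loop_body !rep_nseq /unary /comp.
by congr (_ ++ _); rewrite !catA -!nseqD; congr (nseq _ _ ++ _); nia.
Qed.

Lemma item_range_nil n c s : item_out n (range [::] c s) = unaries (iota (c * n + s) n).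
Proof. exact: item_range. Qed.

Lemma item_range_lines n l c s :
  item_out n (range (false :: unaries l) c s) = lines [seq rcons l k | k <- iota (c * n + s) n].
Proof.
rewrite item_range /lines -map_comp; congr flatten; apply: eq_map => k /=.
by rewrite -cats1 unaries_cat /unaries /= cats0.
Qed.

Definition qcode (i : qinstr) : seq nat :=
  match i with
  | QGate g ps => 0 :: g :: ps
  | QOracle qs t => 1 :: t :: qs
  end.

Lemma parse_q_code m ins : parse_q ([:: m] :: map qcode ins) = Some (m, ins).
Proof.
have H : parse_qinstrs (map qcode ins) = Some ins.
  by elim: ins => [|i ins IH] //=; rewrite IH; case: i.
by rewrite /parse_q H.
Qed.

(* The input occupies the qubits 0, ..., n - 1; the qubits n and n + 1 are idle,
   so that the output qubits 0 and 1 differ from n + 2 and n + 3 even for n < 2. *)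
Definition register n : seq nat := iota (n + 4) n.
Definition layer n : seq qinstr := [seq QGate 0 [:: k] | k <- register n].
Definition swaps n : seq qinstr := [:: QGate 2 [:: 0; n + 2]; QGate 2 [:: 1; n + 3]].

(** Qubit n + 2 is still 0 at the first query and selects the word [false :: y], whose value is
    kicked back as a phase. The second gate 1 leaves qubit n + 3 at 1, so the second query asks
    [true :: z], that is, whether z is zero. The same qubit n + 3 finally serves as a success flag
    that is always set. *)
Definition deutsch n : seq qinstr :=
  layer n ++ [:: QGate 1 [:: n + 3]; QOracle (n + 2 :: register n) (n + 3); QGate 1 [:: n + 3]]
  ++ layer n ++ QOracle (n + 3 :: register n) (n + 2) :: swaps n.

(** The idle qubit n pads the second query to odd length, which turns the question about success
    into one about the value. *)
Definition trial n : seq qinstr :=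
  layer n ++ QOracle (iota 0 n ++ register n) (n + 3)
    :: QOracle (iota 0 n ++ register n ++ [:: n]) (n + 2) :: swaps n.

(** Wires 0 to 2n - 1 hold the input and the random bits. Wire 2n is the success flag and also the
    padding bit of the value query, whose answer is wire 2n + 1. *)
Definition zpp_trial n : seq (seq nat) :=
  [seq [:: 1; i] | i <- iota 0 n] ++ [seq [:: 2; i] | i <- iota 0 n] ++
  [:: 4 :: iota 0 (2 * n); 4 :: iota 0 (2 * n + 1)].

Definition line (l : seq nat) : item := Const (false :: unaries l).
Definition layer_prog : item := range (false :: unaries [:: 0; 0]) 1 4.
Definition swaps_prog : seq item :=
  line [:: 0; 2; 0] :: num 1 2 ++ line [:: 0; 2; 1] :: num 1 3.

Definition deutsch_prog : seq item :=
  num 2 4 ++ layer_prog :: line [:: 0; 1] :: num 1 3 ++ line [:: 1] :: num 1 3 ++ num 1 2 ++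
  range [::] 1 4 :: line [:: 0; 1] :: num 1 3 ++ layer_prog :: line [:: 1] :: num 1 2 ++
  num 1 3 ++ range [::] 1 4 :: swaps_prog.

Definition trial_prog : seq item :=
  num 2 4 ++ layer_prog :: line [:: 1] :: num 1 3 ++ range [::] 0 0 :: range [::] 1 4 ::
  line [:: 1] :: num 1 2 ++ range [::] 0 0 :: range [::] 1 4 :: num 1 0 ++ swaps_prog.

Definition zpp_prog : seq item :=
  num 1 0 ++ num 2 1 ++ num 2 0 ++ range (false :: unaries [:: 1]) 0 0 ::
  range (false :: unaries [:: 2]) 0 0 :: line [:: 4] :: range [::] 0 0 :: range [::] 1 0 ::
  line [:: 4] :: range [::] 0 0 :: range [::] 1 0 :: num 2 0.

Lemma lines_cons l ls : lines (l :: ls) = false :: unaries l ++ lines ls.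
Proof. by []. Qed.

Lemma unaries_cons k l : unaries (k :: l) = unary k ++ unaries l.
Proof. by []. Qed.

Lemma unaries_nil : unaries [::] = [::]. Proof. by []. Qed.

Lemma lines_nil : lines [::] = [::]. Proof. by []. Qed.

Arguments unary : simpl never.
Arguments unaries : simpl never.
Arguments lines : simpl never.

Lemma prog_num_cat n c s p : prog_out n (num c s ++ p) = unary (c * n + s) ++ prog_out n p.
Proof. by rewrite prog_out_cat prog_num. Qed.

Lemma prog_range_cons n c s p : prog_out n (range [::] c s :: p) =
  unaries (iota (c * n + s) n) ++ prog_out n p.
Proof. by rewrite prog_out_cons item_range_nil. Qed.

Lemma prog_range_lines n l c s p : prog_out n (range (false :: unaries l) c s :: p) =
  lines [seq rcons l k | k <- iota (c * n + s) n] ++ prog_out n p.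
Proof. by rewrite prog_out_cons item_range_lines. Qed.

Lemma prog_line n l p : prog_out n (line l :: p) = false :: unaries l ++ prog_out n p.
Proof. by []. Qed.

Definition prog_simp := (prog_num_cat, prog_range_cons, prog_line, prog_num).
Definition lines_simp := (lines_cons, lines_nil, unaries_cons, unaries_nil, cats0).

Lemma prog_layer n p : prog_out n (layer_prog :: p) = lines (map qcode (layer n)) ++ prog_out n p.
Proof. by rewrite prog_range_lines mul1n -map_comp. Qed.

Lemma prog_swaps n : prog_out n swaps_prog = lines (map qcode (swaps n)).
Proof.
by rewrite /swaps_prog !prog_simp !mul1n /= !lines_simp -?catA /= -?catA.
Qed.

Lemma deutsch_progE n :
  prog_out n deutsch_prog = unaries [:: 2 * n + 4] ++ lines (map qcode (deutsch n)).
Proof.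
rewrite /deutsch_prog !(prog_swaps, prog_layer, prog_simp) !mul1n /deutsch !map_cat !lines_cat.
by rewrite /= !lines_simp; do ?[rewrite -!catA /=].
Qed.

Lemma trial_progE n :
  prog_out n trial_prog = unaries [:: 2 * n + 4] ++ lines (map qcode (trial n)).
Proof.
rewrite /trial_prog !(prog_swaps, prog_layer, prog_simp) !mul1n /trial !map_cat !lines_cat.
by rewrite /= !lines_simp !unaries_cat !lines_simp ?addn0; do ?[rewrite -!catA /=].
Qed.

Lemma zpp_progE n :
  prog_out n zpp_prog = unaries [:: n; 2 * n + 1; 2 * n] ++ lines (zpp_trial n).
Proof.
rewrite /zpp_prog !(prog_range_lines, prog_simp) /zpp_trial !lines_cat !lines_cons !mul0n !mul1n.
have -> : iota 0 (2 * n) = iota 0 n ++ iota n n by rewrite mul2n -addnn iotaD.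
have -> : iota 0 (2 * n + 1) = iota 0 n ++ iota n n ++ [:: 2 * n].
  by rewrite mul2n -addnn -addnA !iotaD.
by rewrite !lines_simp !unaries_cat !lines_simp ?addn0; do ?[rewrite -!catA /=].
Qed.

Lemma deutsch_poly : exists2 f, poly_computable f &
  forall x, decode (f x) = [:: 2 * size x + 4] :: map qcode (deutsch (size x)).
Proof.
exists (fun x => prog_out (size x) deutsch_prog); first exact: prog_poly_computable.
by move=> x; rewrite deutsch_progE decode_lines.
Qed.

Lemma trial_poly : exists2 f, poly_computable f &
  forall x, decode (f x) = [:: 2 * size x + 4] :: map qcode (trial (size x)).
Proof.
exists (fun x => prog_out (size x) trial_prog); first exact: prog_poly_computable.
by move=> x; rewrite trial_progE decode_lines.
Qed.

Lemma zpp_poly : exists2 f, poly_computable f & forall x, decode (f x) =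
  [:: size x; 2 * size x + 1; 2 * size x] :: zpp_trial (size x).
Proof.
exists (fun x => prog_out (size x) zpp_prog); first exact: prog_poly_computable.
by move=> x; rewrite zpp_progE decode_lines.
Qed.

(** * Degree of amplitudes *)

Local Open Scope ring_scope.

Section Degree.
Variable T : finType.
Implicit Types (g : {set T} -> algC) (S U : {set T}) (d : nat).

(** A multilinear polynomial in the indicators of membership in U: S stands for the monomial that is
    1 exactly if S is contained in U. *)
Definition degree_le d g := exists c : {set T} -> algC,
  forall U, g U = \sum_(S : {set T} | (#|S| <= d)%N && (S \subset U)) c S.

Lemma degree_le_ext d g g' : g =1 g' -> degree_le d g -> degree_le d g'.
Proof. by move=> e [c hc]; exists c => U; rewrite -e. Qed.

Lemma degree_le_mono d d' g : (d <= d')%N -> degree_le d g -> degree_le d' g.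
Proof.
move=> hd [c hc]; exists (fun S => if (#|S| <= d)%N then c S else 0) => U.
rewrite hc -big_mkcondr; apply: eq_bigl => S.
by rewrite [RHS]andbC; case: (leqP #|S| d) => h //=; rewrite (leq_trans h hd).
Qed.

Lemma degree_le_const d a : degree_le d (fun=> a).
Proof.
exists (fun S => if S == set0 then a else 0) => U.
rewrite (bigD1 set0) /= ?cards0 ?sub0set // eqxx big1 ?addr0 // => S /andP[_ /negbTE].
by move->.
Qed.

Lemma degree_le_sum (I : finType) (a : I -> algC) (g : I -> {set T} -> algC) d :
  (forall i, degree_le d (g i)) -> degree_le d (fun U => \sum_i a i * g i U).
Proof.
move=> /fin_all_exists[c hc]; exists (fun S => \sum_i a i * c i S) => U.
rewrite exchange_big /=; apply: eq_bigr => i _.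
by rewrite hc mulr_sumr.
Qed.

(** Indicators are idempotent, so multiplication by that of w sends the monomial S to [w |: S]; the
    monomials with and without w merge and their coefficients add up. *)
Lemma degree_le_mem d g w : degree_le d g ->
  degree_le d.+1 (fun U => if w \in U then g U else 0).
Proof.
move=> [c hc]; exists (fun S' => \sum_(S : {set T} | (#|S| <= d)%N && (w |: S == S')) c S) => U.
case: ifP => hw; last first.
  rewrite big1 // => S' /andP[_ sS'U]; rewrite big1 // => S /andP[_ /eqP eS'].
  by move: hw; rewrite (subsetP sS'U) // -eS' setU11.
rewrite hc (partition_big (fun S => w |: S)
   (fun S' => (#|S'| <= d.+1)%N && (S' \subset U))) /=.
  apply: eq_bigr => S' /andP[_ sS'U]; apply: eq_bigl => S.
  rewrite -andbA; congr (_ && _); apply/andP/eqP => [[_ /eqP //]|eS'].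
  by split; [apply: subset_trans sS'U; rewrite -eS' subsetU1 | apply/eqP].
move=> S /andP[hS sSU]; rewrite subUset sub1set hw sSU !andbT cardsU1.
by case: (w \notin S); lia.
Qed.

Lemma degree_le_if d g1 g2 w : degree_le d g1 -> degree_le d g2 ->
  degree_le d.+1 (fun U => if w \in U then g1 U else g2 U).
Proof.
move=> h1 h2.
(* With [w] the indicator of w, the function is [w] g1 - [w] g2 + g2. *)
pose g (i : 'I_3) U := nth 0 [:: if w \in U then g1 U else 0;
   if w \in U then g2 U else 0; g2 U] i.
apply: (@degree_le_ext _ (fun U => \sum_(i < 3) (nth 0 [:: 1; -1; 1] i) * g i U)).
  move=> U; rewrite !big_ord_recl big_ord0 /g /=; case: ifP => _.
    by rewrite !mul1r mulN1r addr0 addNr addr0.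
  by rewrite !mulr0 !add0r mul1r addr0.
apply: degree_le_sum => -[i hi]; rewrite /g /=; case: i hi => [|[|[|i]]] //= _.
- exact: degree_le_mem.
- exact: degree_le_mem.
- exact: degree_le_mono h2.
Qed.

(* The coefficients vanish one after the other, by induction on the size of
   the monomial. *)
Lemma degree_le_vanish d g : degree_le d g ->
  (forall U, (#|U| <= d)%N -> g U = 0) -> forall U, g U = 0.
Proof.
move=> [c hc] h0.
suff c0 : forall k S, (#|S| < k)%N -> (#|S| <= d)%N -> c S = 0.
  by move=> U; rewrite hc big1 // => S /andP[hS _]; exact: (c0 #|S|.+1).
elim=> // k IH S hk hS; have := h0 S hS; rewrite hc (bigD1 S) /= ?hS ?subxx //.
rewrite big1 ?addr0 // => S' /andP[/andP[hS' sub] ne].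
have : S' \proper S by rewrite properEneq ne.
by move=> /proper_card hlt; apply: IH => //; apply: leq_trans hlt _.
Qed.

(** Gates act linearly with coefficients independent of U. A query selects between two earlier
    amplitudes according to one membership, which costs one degree. *)
Lemma final_degree_le (A : {set T} -> lang) G m ins x :
  (forall z, exists w a b, forall U, A U z = if w \in U then a else b) ->
  forall b, degree_le (size ins) (fun U => final_state G (A U) m ins x b).
Proof.
move=> hA; rewrite /final_state -[size ins]add0n.
have : forall b, degree_le 0 (fun U => init_state x m b).
  by move=> b; exact: degree_le_const.
move=> h0.
suff H : forall d psi, (forall b, degree_le d (fun U => psi U b)) ->
   forall b, degree_le (d + size ins) (fun U => foldl (apply_qinstr G (A U)) (psi U) ins b).
  exact: (H 0%N (fun=> init_state x m)).
elim: ins {h0} => [|i ins IH] d psi h b /=; first by rewrite addn0.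
rewrite addnS -addSn; apply: IH => {}b; case: i => [g ps|qs t] /=.
  apply: (@degree_le_mono d) => //; exact: degree_le_sum.
rewrite /apply_oracle; have [w [a [a' hw]]] := hA (getbits b qs).
apply: (degree_le_ext _ (degree_le_if w
  (h (set_nth false b t (nth false b t (+) a))) (h (set_nth false b t (nth false b t (+) a'))))).
by move=> U; rewrite hw; case: ifP.
Qed.

End Degree.

(** * The oracle and the lower bound *)

Definition odata := seq bool -> seq bool -> option bool.

(** Words starting with [true] encode the zero test that the Deutsch-Jozsa circuit delegates to its
    oracle. The leading bit makes r one bit longer than y, so n-bit points have 2^(n+1) trials. *)
Definition answer (o : odata) (w r : seq bool) : option bool :=
  match w with
  | [::] => Some true
  | true :: y => Some (~~ has id y)
  | false :: y => o y r
  end.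

Definition probe (b : bool) (v : option bool) : bool :=
  if b then odflt false v else isSome v.

(* A string w ++ r with |w| = |r| asks whether the trial r succeeds on w, and
   w ++ r ++ [:: b] asks for the value that the trial then yields. *)
Definition oracle (o : odata) : lang := fun z =>
  probe (odd (size z)) (answer o (take (size z)./2 z) (take (size z)./2 (drop (size z)./2 z))).

Definition update (o : odata) (n : nat) (c : odata) : odata :=
  fun y r => if size y == n then c y r else o y r.

(** Each oracle bit reads at most one trial, which gives degree one per query. The bound on [size y]
    makes short queries blind to high levels. *)
Lemma oracle_cases z : (exists c, forall o, oracle o z = c) \/
  exists y r, [/\ size r = (size y).+1, (size y < size z)%N &
    forall o, oracle o z = probe (odd (size z)) (o y r)].
Proof.
rewrite /oracle; set l := (size z)./2; set r := take l (drop l z).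
have hl : (l + l <= size z)%N by rewrite addnn halfK leq_subr.
have hr : size r = l by rewrite /r size_take_min size_drop; lia.
have hw : size (take l z) = l by rewrite size_take_min; lia.
case: (take l z) hw => [|[] y] /= hw.
- by left; exists (probe (odd (size z)) (Some true)).
- by left; exists (probe (odd (size z)) (Some (~~ has id y))).
- by right; exists y, r; rewrite hr -hw; split=> //; lia.
Qed.

Lemma eq_oracle o o' z : (forall y r, size r = (size y).+1 -> (size y < size z)%N ->
  o y r = o' y r) -> oracle o z = oracle o' z.
Proof.
move=> h; case: (oracle_cases z) => [[c hc]|[y [r [h1 h2 e]]]]; first by rewrite !hc.
by rewrite !e h.
Qed.

Definition killed n (b : seq bool -> bool) (U : {set n.-tuple bool * n.+1.-tuple bool}) : odata :=
  fun y r => if [exists u in U, (val u.1 == y) && (val u.2 == r)] then None else Some (b y).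

Definition kept n (K : {set n.-tuple bool}) : odata :=
  fun y r => if [exists u in K, val u == y] then Some true else None.

Lemma killedE n b (U : {set n.-tuple bool * n.+1.-tuple bool}) (y : n.-tuple bool)
  (r : n.+1.-tuple bool) : killed b U y r = if (y, r) \in U then None else Some (b y).
Proof.
rewrite /killed; congr (if _ then _ else _); apply/existsP/idP => [[[y' r']]|h].
  by case/and3P => /= h /eqP/val_inj <- /eqP/val_inj <-.
by exists (y, r); rewrite h !eqxx.
Qed.

Lemma keptE n (K : {set n.-tuple bool}) (y : n.-tuple bool) r :
  kept K y r = if y \in K then Some true else None.
Proof.
rewrite /kept; congr (if _ then _ else _); apply/existsP/idP => [[y']|h].
  by case/andP => /= h /eqP/val_inj <-.
by exists y; rewrite h eqxx.
Qed.

Lemma killed_literal o n b z : exists w c c', forall U : {set n.-tuple bool * n.+1.-tuple bool},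
  oracle (update o n (killed b U)) z = if w \in U then c else c'.
Proof.
have w0 : n.-tuple bool * n.+1.-tuple bool by split; apply: (nseq_tuple _ false).
case: (oracle_cases z) => [[c hc]|[y [r [hr _ e]]]].
  by exists w0, c, c => U; rewrite hc if_same.
case: (eqVneq (size y) n) => hy; last first.
  by exists w0, (probe (odd (size z)) (o y r)), (probe (odd (size z)) (o y r)) => U;
    rewrite e /update (negbTE hy) if_same.
have hr' : size r == n.+1 by rewrite hr hy.
have hy' : size y == n by rewrite hy.
exists (Tuple hy', Tuple hr'), (probe (odd (size z)) None), (probe (odd (size z)) (Some (b y))) => U.
by rewrite e /update hy' (killedE b U (Tuple hy') (Tuple hr')); case: ifP.
Qed.

(** All trials on y succeed or fail together, so the single variable [y \in K] controls the bit and
    the degree is counted in points rather than in trials. *)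
Lemma kept_literal o n z : exists w c c', forall K : {set n.-tuple bool},
  oracle (update o n (kept K)) z = if w \in K then c else c'.
Proof.
have w0 : n.-tuple bool by apply: (nseq_tuple _ false).
case: (oracle_cases z) => [[c hc]|[y [r [hr _ e]]]].
  by exists w0, c, c => U; rewrite hc if_same.
case: (eqVneq (size y) n) => hy; last first.
  by exists w0, (probe (odd (size z)) (o y r)), (probe (odd (size z)) (o y r)) => U;
    rewrite e /update (negbTE hy) if_same.
have hy' : size y == n by rewrite hy.
exists (Tuple hy'), (probe (odd (size z)) (Some true)), (probe (odd (size z)) None) => U.
by rewrite e /update hy' (keptE U (Tuple hy')); case: ifP.
Qed.

Lemma superset_card (T : finType) (K : {set T}) k : (#|K| <= k <= #|T|)%N ->
  exists2 S : {set T}, K \subset S & #|S| = k.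
Proof.
case/andP=> hK hk; set s := take (k - #|K|) (enum (~: K)).
have us : uniq s by rewrite take_uniq ?enum_uniq.
have ss : size s = (k - #|K|)%N.
  by have := cardsC K; rewrite size_take_min -cardE; lia.
exists (K :|: [set x in s]); first exact: subsetUl.
rewrite cardsU cardsE (card_uniqP us) ss.
have -> : K :&: [set x in s] = set0.
  apply/setP => x; rewrite !inE; apply/negP => /andP[hx /mem_take].
  by rewrite mem_enum inE hx.
by rewrite cards0; lia.
Qed.

Definition mem_level n (S : {set n.-tuple bool}) (y : seq bool) : bool :=
  [exists u in S, val u == y].

Lemma mem_levelE n (S : {set n.-tuple bool}) (y : n.-tuple bool) : mem_level S y = (y \in S).
Proof.
apply/existsP/idP => [[y']|h]; first by case/andP => /= h /eqP/val_inj <-.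
by exists y; rewrite h eqxx.
Qed.

(** Outside K every trial is dead, so the values of the balanced S are visible only on K, where they
    are all true. *)
Lemma kept_killed o n (K S : {set n.-tuple bool}) : K \subset S ->
  oracle (update o n (kept K)) =
  oracle (update o n (killed (mem_level S) [set u | u.1 \notin K])).
Proof.
move=> sKS; apply: functional_extensionality => z; apply: eq_oracle => y r hr _.
rewrite /update; case: eqVneq => // hy.
have hr' : size r == n.+1 by rewrite hr hy.
have hy' : size y == n by rewrite hy.
rewrite (keptE K (Tuple hy')) (killedE _ _ (Tuple hy') (Tuple hr')) inE /=.
by case: ifPn => // h; rewrite (mem_levelE S (Tuple hy')) (subsetP sKS).
Qed.

Lemma prob_of_eq0 m P psi : prob_of m P psi = 0 <-> forall b : m.-tuple bool, P b -> psi b = 0.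
Proof.
rewrite /prob_of; split=> [h b hb|h]; last first.
  by rewrite big1 // => b /h ->; rewrite normr0 expr0n.
have /eqP := h; rewrite psumr_eq0 => [/allP /(_ b)|? _]; last by rewrite exprn_ge0.
by rewrite mem_index_enum hb /= => /(_ isT); rewrite expf_eq0 normr_eq0 => /eqP.
Qed.

Lemma level_lower_bound o n G m ins x P : (0 < n)%N -> (size ins <= 2 ^ n.-1)%N ->
  (forall (S : {set n.-tuple bool}) (U : {set n.-tuple bool * n.+1.-tuple bool}), #|S| = (2 ^ n.-1)%N -> (#|U| <= 2 ^ n)%N ->
    prob_of m P (final_state G (oracle (update o n (killed (mem_level S) U))) m ins x) = 0) ->
  prob_of m P (final_state G (oracle (update o n (fun _ _ => Some true))) m ins x) = 0.
Proof.
move=> n_gt0 hins h; apply/prob_of_eq0 => b Pb.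
have cardT : #|{: n.-tuple bool}| = (2 ^ n)%N by rewrite card_tuple card_bool.
have le2 : (2 ^ n.-1 <= 2 ^ n)%N by rewrite leq_pexp2l // leq_pred.
(* First interpolation, in the dead trials: the degree is at most 2^(n-1), within the 2^n failures
   that the hypothesis allows, so the size bound on U disappears. *)
have step1 (S : {set n.-tuple bool}) (U : {set n.-tuple bool * n.+1.-tuple bool}) : #|S| = (2 ^ n.-1)%N ->
    final_state G (oracle (update o n (killed (mem_level S) U))) m ins x b = 0.
  move=> hS; have hdeg := final_degree_le G m ins x (@killed_literal o n (mem_level S)) b.
  apply: (degree_le_vanish hdeg) => {}U hU.
  by move/prob_of_eq0: (h S U hS (leq_trans hU (leq_trans hins le2))); apply.
have -> : oracle (update o n (fun _ _ => Some true)) = oracle (update o n (kept [set: n.-tuple bool])).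
  apply: functional_extensionality => z; apply: eq_oracle => y r _ _.
  rewrite /update; case: eqVneq => // hy; have hy' : size y == n by rewrite hy.
  by rewrite (keptE _ (Tuple hy')) inE.
have hdeg := final_degree_le G m ins x (@kept_literal o n) b.
(* Second interpolation, in the points: a K no larger than the degree covers at most half of the
   points and extends to a balanced S. *)
apply: (degree_le_vanish hdeg) => K hK.
have [|S sKS hS] := @superset_card _ K (2 ^ n.-1)%N.
  by rewrite cardT le2 (leq_trans hK).
by rewrite (kept_killed o sKS) step1.
Qed.

(** For valid data this is the common value revealed by all successful trials on y. *)
Definition sel (o : odata) (y : seq bool) : bool :=
  [exists r : (size y).+1.-tuple bool, o y r == Some true].

Definition valid (o : odata) (n : nat) : Prop :=
  [/\ forall y r, size y = n -> size r = n.+1 -> o y r = None \/ o y r = Some (sel o y),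
      forall y, size y = n -> (2 ^ n <= #|[set r : n.+1.-tuple bool | isSome (o y r)]|)%N
    & (forall y, size y = n -> sel o y) \/
      (#|[set y : n.-tuple bool | sel o y]|.*2 = 2 ^ n)%N].

Definition Llang (o : odata) : lang := fun x => [forall y : (size x).-tuple bool, sel o y].

Lemma sel_ext n o o' : (forall y r, size y = n -> o y r = o' y r) ->
  forall y, size y = n -> sel o y = sel o' y.
Proof. by move=> h y hy; apply: eq_existsb => r; rewrite h. Qed.

Lemma valid_ext n o o' : (forall y r, size y = n -> o y r = o' y r) ->
  valid o n -> valid o' n.
Proof.
move=> h [h1 h2 h3]; have hs := sel_ext h; split.
- by move=> y r hy hr; rewrite -h // -hs //; exact: h1.
- by move=> y hy; apply: leq_trans (h2 y hy) _; apply/eq_leq/eq_card => r; rewrite !inE h.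
- case: h3 => h3; [left=> y hy; by rewrite -hs // h3|right].
  by rewrite -h3; congr (_.*2); apply: eq_card => y; rewrite !inE -hs // size_tuple.
Qed.

Lemma Llang_ext n o o' x : (forall y r, size y = n -> o y r = o' y r) -> size x = n ->
  Llang o x = Llang o' x.
Proof. by move=> h hx; apply: eq_forallb => y; rewrite (sel_ext h) // size_tuple. Qed.

Lemma valid_const n : valid (fun _ _ => Some true) n.
Proof.
have selT y : sel (fun _ _ => Some true) y by apply/existsP; exists (nseq_tuple _ true).
split; first by move=> y r _ _; right; rewrite selT.
  move=> y _; have -> : [set r : n.+1.-tuple bool | isSome (Some true)] = setT.
    by apply/setP => r; rewrite !inE.
  by rewrite cardsT card_tuple card_bool leq_exp2l.
by left.
Qed.

Lemma card_pair1 (T1 T2 : finType) (U : {set T1 * T2}) (y : T1) :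
  (#|[set r | (y, r) \in U]| <= #|U|)%N.
Proof.
rewrite -(@card_imset _ _ (fun r => (y, r))); last by move=> r r' [].
by apply: subset_leq_card; apply/subsetP => _ /imsetP[r + ->]; rewrite inE.
Qed.

(** At most 2^n of the 2^(n+1) trials on y are dead, so a surviving one reveals the value. *)
Lemma sel_killed n (S : {set n.-tuple bool}) (U : {set n.-tuple bool * n.+1.-tuple bool}) (y : n.-tuple bool) :
  (#|U| <= 2 ^ n)%N -> sel (killed (mem_level S) U) y = (y \in S).
Proof.
move=> hU; rewrite /sel size_tuple; apply/existsP/idP => [[r]|yS].
  by rewrite killedE mem_levelE; case: ifP => // _ /eqP[].
have : [set r | (y, r) \in U] != setT.
  apply/eqP => e; have := leq_trans (card_pair1 U y) hU.
  by rewrite e cardsT card_tuple card_bool leq_exp2l // ltnn.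
rewrite -subTset => /subsetPn[r _]; rewrite inE => /negbTE hr.
by exists r; rewrite killedE hr mem_levelE yS.
Qed.

Lemma valid_killed n (S : {set n.-tuple bool}) (U : {set n.-tuple bool * n.+1.-tuple bool}) :
  (0 < n)%N -> #|S| = (2 ^ n.-1)%N -> (#|U| <= 2 ^ n)%N -> valid (killed (mem_level S) U) n.
Proof.
move=> n_gt0 hS hU; split.
- move=> y r /eqP hy /eqP hr.
  rewrite (killedE _ U (Tuple hy) (Tuple hr)) -[y]/(val (Tuple hy)) sel_killed //.
  by rewrite mem_levelE; case: ifP; [left|right].
- move=> y /eqP hy; have hc := leq_trans (card_pair1 U (Tuple hy)) hU.
  have -> : [set r : n.+1.-tuple bool | isSome (killed (mem_level S) U y r)] =
      ~: [set r | (Tuple hy, r) \in U].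
    by apply/setP => r; rewrite !inE (killedE _ U (Tuple hy)); case: ifP.
  rewrite -(leq_add2l #|[set r | (Tuple hy, r) \in U]|) cardsC card_tuple card_bool.
  by rewrite expnS mul2n -addnn leq_add2r.
- right; have -> : [set y : n.-tuple bool | sel (killed (mem_level S) U) y] = S.
    by apply/setP => y; rewrite inE sel_killed.
  by rewrite hS -mul2n -expnS prednK.
Qed.

(** * Diagonalization *)

(** A gate is recorded by its entries on strings of the right length, which are the only ones a
    valid circuit reads. These are finitely many algebraic numbers, so the codes form a countable
    type. *)
Definition gate_code := {k : nat & {ffun k.-tuple bool * k.-tuple bool -> algC}}.
Definition tm_code := {qs : nat * nat &
  {ffun 'I_qs.1.+1 * 'I_qs.2.+3 -> option ('I_qs.1.+1 * 'I_qs.2.+3 * bool)}}.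
Definition machine_code := (seq gate_code * tm_code * nat * bool)%type.

Definition decode_gate (c : gate_code) : gate := (tag c, fun a b =>
  match insub a, insub b with
  | Some a', Some b' => tagged c (a', b')
  | _, _ => 0
  end).

Definition encode_gate (g : gate) : gate_code :=
  @existT nat (fun k => {ffun k.-tuple bool * k.-tuple bool -> algC}) g.1
    [ffun ab => g.2 (val ab.1) (val ab.2)].

Definition decode_tm (c : tm_code) : TM :=
  @MkTM (tag c).1 (tag c).2 (fun q s => tagged c (q, s)).

Definition encode_tm (M : TM) : tm_code :=
  @existT (nat * nat) (fun qs =>
    {ffun 'I_qs.1.+1 * 'I_qs.2.+3 -> option ('I_qs.1.+1 * 'I_qs.2.+3 * bool)})
    (tmQ M, tmS M) [ffun p => @tm_delta M p.1 p.2].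

Lemma encode_tmK M : decode_tm (encode_tm M) = M.
Proof.
case: M => Q S d; rewrite /decode_tm /encode_tm /=; congr MkTM.
by do 2![apply: functional_extensionality => ?]; rewrite ffunE.
Qed.

Definition tm_fun (M : TM) (k : nat) (x : seq bool) : seq bool :=
  if tm_run (size x ^ k + k).+1 (init_config M x) is Some c then tm_output c else [::].

(** The enumeration runs over raw codes: gates enter the lower bound only through their linearity.
    The boolean selects the acceptance event, that of NQP or that of ZQP. *)
Definition machine (i : nat) : seq gate * (seq bool -> seq bool) * bool :=
  if (unpickle i : option machine_code) is Some (gs, M, k, e)
  then (map decode_gate gs, tm_fun (decode_tm M) k, e) else ([::], fun=> [::], false).

Lemma decode_gateE g a b : size a = g.1 -> size b = g.1 ->
  (decode_gate (encode_gate g)).2 a b = g.2 a b.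
Proof.
move=> /eqP ha /eqP hb; rewrite /= (insubT (fun s => size s == g.1) ha).
by rewrite (insubT (fun s => size s == g.1) hb) ffunE.
Qed.

Lemma final_decode_gate G A m ins x : all (valid_qinstr G m) ins ->
  final_state (map decode_gate (map encode_gate G)) A m ins x = final_state G A m ins x.
Proof.
rewrite /final_state; elim: ins (init_state x m) => //= i ins IH psi /andP[hi hins].
rewrite IH //; congr foldl; case: i hi => //= g ps /and4P[hg /eqP hps _ _].
rewrite -map_comp (nth_map dflt_gate) //; apply: functional_extensionality => b.
apply: eq_bigr => c _; congr (_ * _).
by apply: decode_gateE; rewrite ?size_map ?size_tuple.
Qed.

Lemma machine_complete G f e : qfamily G f -> exists i, (machine i).2 = e /\
  forall A x P, qprob (machine i).1.1 (machine i).1.2 A x P = qprob G f A x P.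
Proof.
case=> _ [M [k hM]] wf.
exists (pickle (map encode_gate G, encode_tm M, k, e)).
rewrite /machine pickleK; split=> // A x P.
have fE : tm_fun M k = f.
  by apply: functional_extensionality => y; rewrite /tm_fun; have [c [-> ->]] := hM y.
rewrite /qprob encode_tmK [X in X.1.1]/= [X in X.1.2]/= fE.
have [m [ins [-> [_ hv]]]] := wf x.
by rewrite final_decode_gate.
Qed.

(** The head uncovers at most one new cell per step. This bounds the length of the description, and
    with it the number of instructions and the length of the queries. *)
Lemma tm_run_size M n (c c' : config M) : tm_run n c = Some c' ->
  (size (c_right c') <= size (c_right c) + n)%N.
Proof.
elim: n c => //= n IH c; case E: (tm_step c) => [c1|]; last by case=> <-; exact: leq_addr.
move=> /IH; move: E; rewrite /tm_step; case: (tm_delta _ _) => [[[q s] []]|] //= [<-] /=.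
  by rewrite size_behead; lia.
by lia.
Qed.

Lemma size_read_bits n (s : seq 'I_n) : (size (read_bits s) <= size s)%N.
Proof. by elim: s => //= a s IH; case: ifP => // _; case: ifP. Qed.

Lemma machine_size i : poly_bounded (fun n => size ((machine i).1.2 (nseq n false))).
Proof.
rewrite /machine; case: unpickle => [[[[gs M] k] e]|] /=; last exact: poly_bounded_const 0%N.
apply: (@poly_bounded_le _ (fun n => n + (n ^ k + (k + 2))))%N => [n|].
  rewrite /tm_fun size_nseq; case E: tm_run => [c|] //.
  apply: leq_trans (size_read_bits _) _; have := tm_run_size E.
  by rewrite /= size_behead size_map size_nseq; lia.
apply: poly_bounded_add poly_bounded_id (poly_bounded_add (poly_bounded_exp k) _).
exact: poly_bounded_const.
Qed.

Lemma poly_bounded_exp2 f N : poly_bounded f ->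
  exists n, [&& (0 < n)%N, (N <= n)%N & (f n <= 2 ^ n.-1)%N].
Proof.
(* The n chosen makes n + 2 = 2^(2a) a power of two, so (n + 2)^k = 2^(2ak) and only 2ak <= n - 1
   remains. This and N <= n follow from 2^(2a) > a^2 and the choice of a. *)
move=> [k hk]; set a := (2 * k + N + 3)%N.
have ha : (a < 2 ^ a)%N by apply: ltn_expl.
have e2 : (2 ^ (2 * a) = 2 ^ a * 2 ^ a)%N by rewrite mul2n -addnn expnD.
exists (2 ^ (2 * a) - 2)%N.
have h1 : (2 * a * k + N + 3 <= 2 ^ (2 * a))%N by rewrite e2; nia.
apply/and3P; split; [nia|nia|].
apply: leq_trans (hk _) _.
have -> : (2 ^ (2 * a) - 2).+2 = (2 ^ (2 * a))%N by nia.
by rewrite -expnM leq_pexp2l //; nia.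
Qed.

Definition input n : seq bool := nseq n false.
Definition code_size i n : nat := size ((machine i).1.2 (input n)).
Definition event (e : bool) (b : seq bool) : bool := nth false b 0 && (e ==> nth false b 1).
Definition accepts i (o : odata) n : bool :=
  0 < qprob (machine i).1.1 (machine i).1.2 (oracle o) (input n) (event (machine i).2).

Lemma level_exists i N :
  exists n, [&& (0 < n)%N, (N <= n)%N & (code_size i n <= 2 ^ n.-1)%N].
Proof. exact: poly_bounded_exp2 (machine_size i). Qed.

Definition level_above i N := xchoose (level_exists i N).

Lemma level_aboveP i N : [&& (0 < level_above i N)%N, (N <= level_above i N)%N
  & (code_size i (level_above i N) <= 2 ^ (level_above i N).-1)%N].
Proof. exact: (xchooseP (level_exists i N)). Qed.

(** Exceeding the previous code size puts all later levels out of reach of the queries of machine i'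
    on its own input. *)
Fixpoint level i : nat :=
  if i is i'.+1 then level_above i (maxn (level i') (code_size i' (level i'))).+1
  else level_above 0 0.

Lemma level_spec i : (0 < level i)%N /\ (code_size i (level i) <= 2 ^ (level i).-1)%N.
Proof. case: i => [|i]; first by have /and3P[] := level_aboveP 0 0.
by have /and3P[] := level_aboveP i.+1 (maxn (level i) (code_size i (level i))).+1.
 Qed.

Lemma level_next i : (maxn (level i) (code_size i (level i)) < level i.+1)%N.
Proof. by have /and3P[] := level_aboveP i.+1 (maxn (level i) (code_size i (level i))).+1. Qed.

Lemma level_lt i j : (i < j)%N -> (maxn (level i) (code_size i (level i)) < level j)%N.
Proof.
elim: j => // j IH; rewrite ltnS leq_eqVlt => /predU1P[->|/IH h]; first exact: level_next.
by have := level_next j; lia.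
Qed.

Lemma level_ge i : (i <= level i)%N.
Proof. by elim: i => // i IH; have := level_next i; lia. Qed.

Lemma size_blocks s acc : (size (blocks s acc) <= size s)%N.
Proof. by elim: s acc => // -[] s IH acc /=; [exact: leqW | exact: IH]. Qed.

Lemma group_blocks_size l cur : (size (group_blocks l cur) <= (size l).+1)%N /\
  all (fun s => (size s <= size l + size cur)%N) (group_blocks l cur).
Proof.
elim: l cur => [|[|k] l IH] cur /=; first by split=> //; rewrite size_rev add0n leqnn.
  have [h1 h2] := IH [::]; rewrite size_rev; split=> //; apply/andP; split; first lia.
  by apply: sub_all h2 => s /=; lia.
have [h1 h2] := IH (k :: cur); split; first lia.
by apply: sub_all h2 => s /=; lia.
Qed.

Lemma decode_size s : (size (decode s) <= (size s).+1)%N /\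
  all (fun l => (size l <= size s)%N) (decode s).
Proof.
have [h1 h2] := group_blocks_size (blocks s 0) [::]; have h := size_blocks s 0.
split; first by apply: leq_trans h1 _.
by apply: sub_all h2 => l /=; lia.
Qed.

Definition short_query N (i : qinstr) : bool :=
  if i is QOracle qs _ then (size qs <= N)%N else true.

Lemma parse_qinstrs_size ls ins N : parse_qinstrs ls = Some ins ->
  all (fun l => (size l <= N)%N) ls -> (size ins = size ls) /\ all (short_query N) ins.
Proof.
elim: ls ins => [|l ls IH] ins /=; first by case=> <-.
case E: (parse_qinstr l) => [i|] //; case E2: (parse_qinstrs ls) => [ins'|] //.
case=> <- /andP[hl hls]; have [h1 h2] := IH _ E2 hls; rewrite /= h1 h2 andbT; split=> //.
case: l E hl => [|[|[|k]] [|g ps]] //= [<-] //= h; lia.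
Qed.

Lemma parse_q_size s m ins : parse_q (decode s) = Some (m, ins) ->
  (size ins <= size s)%N /\ all (short_query (size s)) ins.
Proof.
have [] := decode_size s; case: (decode s) => [|[|m' [|? ?]] rest] //= h1 /andP[_ h2].
case E: (parse_qinstrs rest) => [ins'|] //= [_ <-].
by have [-> ->] := parse_qinstrs_size E h2.
Qed.

Lemma eq_qprob G f x P (A A' : lang) : (forall z, (size z <= size (f x))%N -> A z = A' z) ->
  qprob G f A x P = qprob G f A' x P.
Proof.
rewrite /qprob => h; case E: parse_q => [[m ins]|] //.
have [_] := parse_q_size E; rewrite /final_state.
suff H psi : all (short_query (size (f x))) ins ->
    foldl (apply_qinstr G A) psi ins = foldl (apply_qinstr G A') psi ins.
  by move=> /H ->.
elim: ins {E} psi => //= i ins IH psi /andP[hi hins]; rewrite IH //; congr foldl.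
case: i hi => //= qs t hq; apply: functional_extensionality => b.
by rewrite /apply_oracle h // size_map.
Qed.

Lemma prob_of_ge0 m P psi : 0 <= prob_of m P psi.
Proof. by apply: sumr_ge0 => b _; rewrite exprn_ge0. Qed.

(** With the level constantly true, its input is in the language, so a machine that does not accept
    is already wrong. A machine that accepts must, by the lower bound, also accept for some valid
    balanced function, where the input is not in the language. *)
Lemma defeat_step i o :
  (forall y r, size y = level i -> o y r = Some true) ->
  exists o', [/\ valid o' (level i), forall y r, size y != level i -> o' y r = o y r
    & accepts i o' (level i) != Llang o' (input (level i))].
Proof.
set n := level i => hconst; have [n_gt0 hsize] := level_spec i.
have hL0 : Llang o (input n).
  apply/forallP => y; apply/existsP; exists (nseq_tuple _ false).
  by rewrite hconst // size_tuple size_nseq.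
case E: (accepts i o n); last first.
  exists o; split=> //; last by rewrite E hL0.
  by apply: valid_ext (valid_const n) => y r /hconst ->.
case: (boolP [exists SU : {set n.-tuple bool} * {set n.-tuple bool * n.+1.-tuple bool},
   [&& #|SU.1| == (2 ^ n.-1)%N, (#|SU.2| <= 2 ^ n)%N &
     accepts i (update o n (killed (mem_level SU.1) SU.2)) n]]).
  case/existsP => -[S U] /and3P[/= /eqP hS hU hacc].
  exists (update o n (killed (mem_level S) U)); split.
  - apply: valid_ext (valid_killed n_gt0 hS hU) => y r hy.
    by rewrite /update hy eqxx.
  - by move=> y r /negbTE; rewrite /update => ->.
  rewrite hacc; apply/eqP => /esym/forallP hall.
  have : [set y : n.-tuple bool | sel (killed (mem_level S) U) y] = setT.
    apply/setP => y; rewrite !inE; have sz : size (input n) = n by rewrite size_nseq.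
    have := hall (tcast (esym sz) y); rewrite val_tcast.
    rewrite (@sel_ext n _ (killed (mem_level S) U)) ?size_tuple // => y' r hy'.
    by rewrite /update hy' eqxx.
  move=> eT; have : S = setT by rewrite -eT; apply/setP => y; rewrite inE sel_killed.
  move=> eS; move: hS; rewrite eS cardsT card_tuple card_bool => /eqP.
  by rewrite eqn_exp2l // => /eqP; lia.
(* If no such balanced function is accepted, the lower bound gives acceptance probability 0 for the
   constant one, against [E]. *)
move=> /existsPn hno; exfalso.
move: E; rewrite /accepts /qprob; case Ep: parse_q => [[m ins]|]; last by rewrite ltxx.
have [hins _] := parse_q_size Ep.
have := @level_lower_bound o n (machine i).1.1 m ins (input n) (event (machine i).2) n_gt0
   (leq_trans hins hsize).
have -> : oracle (update o n (fun _ _ => Some true)) = oracle o.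
  apply: functional_extensionality => z; apply: eq_oracle => y r _ _.
  by rewrite /update; case: eqVneq => // /hconst ->.
move=> -> //; first by rewrite ltxx.
move=> S U hS hU; have := hno (S, U); rewrite /= hS eqxx hU /=.
by rewrite /accepts /qprob Ep lt0r prob_of_ge0 andbT negbK => /eqP.
Qed.

(** Stating the premise as an implication makes a suitable [o'] exist for every [o], so [next] can
    be chosen as a total function; [stageP] supplies the premise along the construction. *)
Definition defeats i (o o' : odata) : Prop :=
  (forall y r, size y = level i -> o y r = Some true) ->
  [/\ valid o' (level i), forall y r, size y != level i -> o' y r = o y r
    & accepts i o' (level i) != Llang o' (input (level i))].

Lemma defeats_exists i o : exists o', defeats i o o'.
Proof.
case: (excluded_middle_informative (forall y r, size y = level i -> o y r = Some true)) => h.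
  by have [o' ho'] := defeat_step h; exists o'.
by exists o => /h.
Qed.

Definition next i o : odata :=
  proj1_sig (constructive_indefinite_description _ (defeats_exists i o)).

Lemma nextP i o : defeats i o (next i o).
Proof. exact: proj2_sig (constructive_indefinite_description _ (defeats_exists i o)). Qed.

Fixpoint stage i : odata :=
  if i is i'.+1 then next i' (stage i') else fun _ _ => Some true.

Lemma level_inj_lt i j : (i < j)%N -> (level i < level j)%N.
Proof. by move=> /level_lt; lia. Qed.

Lemma stageP i : [/\ forall j, (i <= j)%N -> forall y r, size y = level j -> stage i y r = Some true,
  forall n, valid (stage i) n &
  forall y r, size y != level i -> stage i.+1 y r = stage i y r].
Proof.
elim: i => [|i [h1 h2 h3]]; last first.
  have [v _ _] := nextP (h1 i (leqnn i)).
  have h1' j : (i.+1 <= j)%N -> forall y r, size y = level j -> stage i.+1 y r = Some true.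
    move=> hij y r hy; rewrite h3; first by apply: (h1 j) => //; exact: ltnW.
    by rewrite hy; have := level_inj_lt hij; lia.
  split=> // [n|y r hy].
    case: (eqVneq n (level i)) => [->|hn]; first exact: v.
    by apply: valid_ext (h2 n) => y r hy; rewrite h3 // hy.
  by have [_ h _] := nextP (h1' i.+1 (leqnn _)); exact: h.
split=> // [n|y r hy]; first exact: valid_const.
by have [|_ h _] := @nextP 0 (stage 0); last exact: h.
Qed.

Lemma stage_stable i j y r : (i <= j)%N -> (size y < level i)%N -> stage j y r = stage i y r.
Proof.
elim: j => [|j IH]; first by rewrite leqn0 => /eqP ->.
rewrite leq_eqVlt => /predU1P[-> //|]; rewrite ltnS => hij hy.
have [_ _ ->] := stageP j; first exact: IH.
apply/eqP => e; move: hij; rewrite leq_eqVlt => /predU1P[eij|/level_inj_lt]; last lia.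
by rewrite -eij in e; lia.
Qed.

(** Since [level i] is at least i, stages after [(size y).+1] no longer change the data at y. *)
Definition limit : odata := fun y r => stage (size y).+1 y r.

Lemma limitE i y r : (size y < level i)%N -> limit y r = stage i y r.
Proof.
move=> hy; rewrite /limit; have hs : (size y < level (size y).+1)%N by exact: level_ge.
case: (leqP (size y).+1 i) => h; first by rewrite (stage_stable r h hs).
by rewrite (stage_stable r (ltnW h) hy).
Qed.

Lemma diagonal : (forall n, valid limit n) /\ forall G f e, qfamily G f ->
  ~ (forall x, (0 < qprob G f (oracle limit) x (event e)) = Llang limit x).
Proof.
split=> [n|G f e fam H].
  have [_ /(_ n) h _] := stageP n.+1; apply: valid_ext h => y r hy.
  by rewrite (@limitE n.+1) // hy; exact: level_ge.
have [i [ei ef]] := machine_complete e fam.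
have [h1 _ _] := stageP i; have [_ _ /eqP[]] := nextP (h1 i (leqnn i)).
rewrite -/(stage i.+1); have hlev := level_next i.
rewrite -(@Llang_ext (level i) limit); last by rewrite size_nseq.
  (* The queries of machine i are no longer than its code, hence shorter than [level i.+1], and
     below that level [limit] agrees with [stage i.+1]. *)
  rewrite -H -ei -ef /accepts; congr (_ < _); apply: eq_qprob => z hz.
  apply: eq_oracle => y r _ hy; rewrite (@limitE i.+1) //.
  by move: hz; rewrite -/(code_size i (level i)); lia.
by move=> y r hy; rewrite (@limitE i.+1) // hy; lia.
Qed.

(** * States of quantum circuits *)

(** Sums over this list split by the first bit without dependent types, which suits inductions on
    the number of qubits. *)
Fixpoint strings (n : nat) : seq (seq bool) :=
  if n is n'.+1 then map (cons false) (strings n') ++ map (cons true) (strings n')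
  else [:: [::]].

Lemma mem_strings n s : (s \in strings n) = (size s == n).
Proof.
have inj b : injective (cons b : seq bool -> _) by move=> ? ? [].
elim: n s => [|n IH] [|b s] /=; rewrite ?inE // mem_cat.
  by apply/negP => /orP[]/mapP[].
rewrite eqSS -IH; case: b; rewrite (mem_map (@inj _)).
  by case: (boolP (_ \in map (cons false) _)) => // /mapP[].
by case: (boolP (_ \in map (cons true) _)) => [/mapP[]|] // _; rewrite orbF.
Qed.

Lemma size_strings n s : s \in strings n -> size s = n.
Proof. by rewrite mem_strings => /eqP. Qed.

Lemma strings_uniq n : uniq (strings n).
Proof.
elim: n => //= n IH; rewrite cat_uniq !map_inj_uniq ?IH ?andbT //; try by move=> ? ? [].
by apply/hasPn => _ /mapP[s _ ->]; apply/mapP => -[].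
Qed.

Lemma big_strings (R : Type) (idx : R) (op : Monoid.com_law idx) n (P : pred (seq bool))
    (F : seq bool -> R) :
  \big[op/idx]_(t : n.-tuple bool | P t) F t = \big[op/idx]_(s <- strings n | P s) F s.
Proof.
rewrite -(big_map val P F); apply: perm_big; apply: uniq_perm.
- by rewrite map_inj_uniq ?index_enum_uniq //; exact: val_inj.
- exact: strings_uniq.
move=> s; rewrite mem_strings; apply/mapP/eqP => [[t _ ->]|hs]; first exact: size_tuple.
by exists (Tuple (introT eqP hs)) => //; rewrite mem_index_enum.
Qed.

Lemma big_stringsS (R : Type) (idx : R) (op : Monoid.law idx) n (F : seq bool -> R) :
  \big[op/idx]_(s <- strings n.+1) F s =
  op (\big[op/idx]_(s <- strings n) F (false :: s)) (\big[op/idx]_(s <- strings n) F (true :: s)).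
Proof. by rewrite /= big_cat !big_map. Qed.

Lemma size_strings_card n : size (strings n) = (2 ^ n)%N.
Proof. by elim: n => //= n IH; rewrite size_cat !size_map IH addnn -mul2n expnS. Qed.

Definition ket (s : seq bool) : qstate := fun b => (b == s)%:R.
Definition run (G : seq gate) (A : lang) (ins : seq qinstr) (psi : qstate) : qstate :=
  foldl (apply_qinstr G A) psi ins.
Arguments run : simpl never.
(** Amplitudes at strings of other lengths are meaningless, and the descriptions of gates on basis
    states hold only at length m. *)
Definition same_on (m : nat) (psi phi : qstate) : Prop := forall b, size b = m -> psi b = phi b.

Lemma same_on_trans m psi phi chi : same_on m psi phi -> same_on m phi chi -> same_on m psi chi.
Proof. by move=> h1 h2 b hb; rewrite h1 // h2. Qed.

Lemma run_cat G A i j psi : run G A (i ++ j) psi = run G A j (run G A i psi).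
Proof. exact: foldl_cat. Qed.

Lemma run_cons G A i j psi : run G A (i :: j) psi = run G A j (apply_qinstr G A psi i).
Proof. by []. Qed.

Lemma size_setbits b ps c : all (fun p => (p < size b)%N) ps -> size (setbits b ps c) = size b.
Proof.
rewrite /setbits; elim: ps c b => [|p ps IH] [|v c] b //= /andP[hp hps].
have hs : size (set_nth false b p v) = size b by rewrite size_set_nth; apply/maxn_idPr.
by rewrite IH hs.
Qed.

Section Run.
Variables (G : seq gate) (A : lang) (m : nat).

Lemma apply_same i psi phi : valid_qinstr G m i -> same_on m psi phi ->
  same_on m (apply_qinstr G A psi i) (apply_qinstr G A phi i).
Proof.
case: i => [g ps /and4P[_ _ _ hps]|qs t /= /and3P[_ ht _]] h b hb /=.
  by apply: eq_bigr => c _; rewrite h // size_setbits ?hb.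
by rewrite /apply_oracle h // size_set_nth hb; apply/maxn_idPr.
Qed.

Lemma run_same ins psi phi : all (valid_qinstr G m) ins -> same_on m psi phi ->
  same_on m (run G A ins psi) (run G A ins phi).
Proof.
elim: ins psi phi => //= i ins IH psi phi /andP[hi hins] h.
exact: IH hins (apply_same hi h).
Qed.

Lemma run_sum ins (I : Type) (r : seq I) (a : I -> algC) (psi : I -> qstate) :
  run G A ins (fun b => \sum_(i <- r) a i * psi i b) =
  (fun b => \sum_(i <- r) a i * run G A ins (psi i) b).
Proof.
elim: ins psi => // i ins IH psi.
rewrite -[RHS]/(fun b => \sum_(j <- r) a j * run G A ins (apply_qinstr G A (psi j) i) b) -IH.
rewrite run_cons; congr run.
apply: functional_extensionality => b; case: i => [g ps|qs t] //=.
rewrite /apply_gate; under eq_bigr => c _ do rewrite mulr_sumr.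
rewrite exchange_big /=; apply: eq_bigr => j _; rewrite mulr_sumr.
by apply: eq_bigr => c _; rewrite mulrCA.
Qed.

(** By linearity the rest of a circuit may be analysed on each basis state separately. *)
Lemma run_expand ins (I : eqType) (r : seq I) (a : I -> algC) (psi : qstate) (phi phi' : I -> qstate) :
  all (valid_qinstr G m) ins ->
  same_on m psi (fun b => \sum_(i <- r) a i * phi i b) ->
  (forall i, i \in r -> same_on m (run G A ins (phi i)) (phi' i)) ->
  same_on m (run G A ins psi) (fun b => \sum_(i <- r) a i * phi' i b).
Proof.
move=> hins h h' b hb; rewrite (run_same hins h) // run_sum.
by apply: eq_big_seq => i ir; rewrite h'.
Qed.

Lemma run_scale ins psi phi (c : algC) :
  all (valid_qinstr G m) ins -> same_on m psi (fun b => c * phi b) ->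
  same_on m (run G A ins psi) (fun b => c * run G A ins phi b).
Proof.
move=> hins h b hb; have h' : same_on m psi (fun b => \sum_(i <- [:: tt]) c * phi b).
  by move=> b' hb'; rewrite big_seq1 h.
by rewrite (run_expand (phi' := fun=> run G A ins phi) hins h') // big_seq1.
Qed.

End Run.

Lemma set_nth_id (b : seq bool) p : (p < size b)%N -> set_nth false b p (nth false b p) = b.
Proof.
move=> hp; apply: (@eq_from_nth _ false) => [|i _].
  by rewrite size_set_nth; apply/maxn_idPr.
by rewrite nth_set_nth /=; case: eqP => // ->.
Qed.

Lemma size_set_nth_lt (b : seq bool) p v : (p < size b)%N -> size (set_nth false b p v) = size b.
Proof. by move=> hp; rewrite size_set_nth; apply/maxn_idPr. Qed.

Lemma set_nth_eq (b s : seq bool) p c : (p < size b)%N -> size b = size s ->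
  (set_nth false b p c == s) = (c == nth false s p) && (b == set_nth false s p (nth false b p)).
Proof.
move=> hp hs; apply/eqP/andP => [<-|[/eqP -> /eqP e]].
  by rewrite nth_set_nth /= set_set_nth !eqxx set_nth_id.
by rewrite e set_set_nth eqxx set_nth_id // -hs.
Qed.

Lemma eq_set_nth (c : bool) (b s : seq bool) p : (p < size b)%N -> size b = size s ->
  (b == set_nth false s p c) = (c == nth false b p) && (b == set_nth false s p (nth false b p)).
Proof.
move=> hp hs; have hp' : (p < size s)%N by rewrite -hs.
by rewrite eq_sym set_nth_eq // [s == _]eq_sym set_nth_eq // eqxx.
Qed.

Lemma gate1_ket G A m g p s : (nth dflt_gate G g).1 = 1%N -> (p < m)%N -> size s = m ->
  same_on m (apply_qinstr G A (ket s) (QGate g [:: p]))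
   (fun b => \sum_(c <- [:: false; true])
      (nth dflt_gate G g).2 [:: c] [:: nth false s p] * ket (set_nth false s p c) b).
Proof.
move=> hU hp hs b hb /=; rewrite /apply_gate; case: (nth _ _ _) hU => k U /= ->.
rewrite (@big_strings _ _ _ _ predT (fun c => U (getbits b [:: p]) c * ket s (setbits b [:: p] c))).
rewrite big_stringsS !big_seq1 /= !big_cons big_nil /= addr0 /ket /setbits /=.
rewrite ![in LHS]set_nth_eq ?hb ?hs // .
rewrite (eq_set_nth false) ?hb ?hs // (eq_set_nth true) ?hb ?hs //; case: (b == _); rewrite ?andbF ?andbT ?mulr0 ?addr0 //.
by case: (nth false b p); case: (nth false s p); rewrite ?eqxx ?mulr0 ?mulr1 ?addr0 ?add0r.
Qed.

(** [apply_oracle] looks up the preimage of b. As t is not in the query register, the query is its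
    own inverse and preimage and image coincide. *)
Lemma oracle_ket G A m qs t s : t \notin qs -> (t < m)%N -> size s = m ->
  same_on m (apply_qinstr G A (ket s) (QOracle qs t))
    (ket (set_nth false s t (nth false s t (+) A (getbits s qs)))).
Proof.
move=> ht hlt hs b hb /=; rewrite /apply_oracle /ket.
have hq : forall c, getbits (set_nth false b t c) qs = getbits b qs.
  move=> c; apply/eq_in_map => q hq; rewrite nth_set_nth /=.
  by case: eqP => // e; move: ht; rewrite -e hq.
rewrite set_nth_eq ?hb ?hs // (eq_set_nth (nth false s t (+) _)) ?hb ?hs //.
case: (eqVneq b (set_nth false s t _)) => [e|_]; rewrite ?andbF ?andbT //; congr (nat_of_bool _)%:R.
have -> : getbits s qs = getbits b qs.
  apply/eq_in_map => q qin; rewrite e nth_set_nth /=.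
  by case: eqP => // e'; move: ht; rewrite -e' qin.
by case: (nth false b t); case: (nth false s t); case: (A _).
Qed.

Definition exchange (s : seq bool) (p q : nat) : seq bool :=
  set_nth false (set_nth false s p (nth false s q)) q (nth false s p).

Lemma size_exchange s p q : (p < size s)%N -> (q < size s)%N -> size (exchange s p q) = size s.
Proof. by move=> hp hq; rewrite /exchange !size_set_nth_lt ?size_set_nth_lt. Qed.

Lemma nth_exchange s p q i : nth false (exchange s p q) i =
  if i == q then nth false s p else if i == p then nth false s q else nth false s i.
Proof. by rewrite /exchange !nth_set_nth /= nth_set_nth /=. Qed.

Lemma exchangeK s p q : (p < size s)%N -> (q < size s)%N -> exchange (exchange s p q) p q = s.
Proof.
move=> hp hq; have hz := size_exchange hp hq.
apply: (@eq_from_nth _ false) => [|i _]; first by rewrite size_exchange hz.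
rewrite !nth_exchange !eqxx; case: (eqVneq i q) => [->|_]; first by case: eqVneq => [->|].
by case: (eqVneq i p) => [->|].
Qed.

Lemma exchange_ket G A m g p q s : (nth dflt_gate G g).1 = 2%N ->
  (forall b a, (nth dflt_gate G g).2 b a = (b == rev a)%:R) ->
  p != q -> (p < m)%N -> (q < m)%N -> size s = m ->
  same_on m (apply_qinstr G A (ket s) (QGate g [:: p; q])) (ket (exchange s p q)).
Proof.
move=> h1 h2 hpq hp hq hs b hb /=; rewrite /apply_gate.
under eq_bigr => c _ do rewrite h2; case: (nth _ _ _) h1 => k U /= ->.
rewrite (@big_strings _ _ _ _ predT (fun c => (getbits b [:: p; q] == rev c)%:R * ket s (setbits b [:: p; q] c))).
have hk : ket s (exchange b p q) = ket (exchange s p q) b.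
  rewrite /ket; congr (nat_of_bool _)%:R; by apply/eqP/eqP => [<-|->]; rewrite exchangeK ?hb ?hs.
rewrite -hk /exchange !big_stringsS !big_seq1 /setbits /getbits /=.
case: (nth false b p); case: (nth false b q); rewrite /= ?mul1r ?mul0r ?addr0 ?add0r //.
Qed.

(** Distinct indices lead to distinct basis strings, so there is no interference and the squared
    moduli add up. *)
Lemma prob_outcomes (I : eqType) (Y : seq I) (a : I -> algC) (f : I -> seq bool) m P psi :
  uniq Y -> {in Y &, injective f} -> {in Y, forall y, size (f y) = m} ->
  same_on m psi (fun b => \sum_(y <- Y) a y * ket (f y) b) ->
  prob_of m P psi = \sum_(y <- Y | P (f y)) `|a y| ^+ 2.
Proof.
move=> uY inj_f szf h.
rewrite /prob_of (@big_strings _ _ _ _ P (fun b => `|psi b| ^+ 2)).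
have E b : size b = m -> `|psi b| ^+ 2 = \sum_(y <- Y) `|a y| ^+ 2 * (f y == b)%:R.
  move=> hb; rewrite h //; case: (boolP (b \in map f Y)) => [/mapP[y0 y0Y ->]|hb'].
    rewrite (bigD1_seq y0) //= /ket eqxx mulr1 big_seq_cond big1 ?addr0; last first.
      by move=> y /andP[yY ne]; rewrite eq_sym (inj_in_eq inj_f) // (negbTE ne) mulr0.
    rewrite (bigD1_seq y0) //= eqxx mulr1 big_seq_cond big1 ?addr0 // => y /andP[yY ne].
    by rewrite (inj_in_eq inj_f) // (negbTE ne) mulr0.
  have hn y : y \in Y -> (f y == b) = false.
    by move=> yY; apply: contraNF hb' => /eqP <-; apply: map_f.
  rewrite !big_seq !big1 ?normr0 ?expr0n // => y yY; first by rewrite hn // mulr0.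
  by rewrite /ket eq_sym hn // mulr0.
rewrite big_seq_cond.
under eq_bigr => b /andP[hb _] do rewrite E ?(size_strings hb) //.
rewrite -big_seq_cond exchange_big /= [RHS]big_mkcond /=; apply: eq_big_seq => y yY.
rewrite -mulr_sumr; case: ifP => hP; last first.
  rewrite big1 ?mulr0 // => b Pb; case: eqP => // e; by rewrite e Pb in hP.
rewrite big_mkcond (bigD1_seq (f y)) ?strings_uniq ?mem_strings ?szf //= hP eqxx.
by rewrite big1 ?addr0 ?mulr1 // => b /negbTE; rewrite eq_sym => ->; rewrite if_same.
Qed.

(** * Hadamard layers and phase kickback *)

Definition isq2 : algC := (sqrtC 2%:R)^-1.

Lemma isq2_sq : isq2 * isq2 = 2%:R^-1.
Proof. by rewrite /isq2 -invfM -expr2 sqrtCK. Qed.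

Lemma isq2_real : isq2 \is Num.real.
Proof. by rewrite realV ger0_real // sqrtC_ge0 ler0n. Qed.

Lemma isq2_conj : isq2^* = isq2.
Proof. exact/CrealP/isq2_real. Qed.

Lemma half2 : 2%:R^-1 + 2%:R^-1 = 1 :> algC.
Proof. by field. Qed.

Lemma sign_conj (b : bool) : ((-1 : algC) ^+ b)^* = (-1) ^+ b.
Proof. by rewrite rmorphXn rmorphN1. Qed.

Lemma isq2_sign (a b : bool) :
  (isq2 * (-1) ^+ a)^* * (isq2 * (-1) ^+ b) = 2%:R^-1 * (-1) ^+ (a (+) b).
Proof. by rewrite rmorphM /= isq2_conj sign_conj mulrACA isq2_sq -signr_addb. Qed.

Definition hgate : gate := (1%N, fun b a => isq2 * (-1) ^+ (head false b && head false a)).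
(* The Hadamard gate precomposed with a negation: it maps |0> to (|0> - |1>) / sqrt 2,
   and that state to - |1>. *)
Definition pgate : gate := (1%N, fun b a => isq2 * (-1) ^+ (head false b && ~~ head false a)).
Definition sgate : gate := (2%N, fun b a => (b == rev a)%:R).
Definition gates : seq gate := [:: hgate; pgate; sgate].

Lemma tuple1 T (t : 1.-tuple T) : exists x, t = [tuple x].
Proof. by case/tupleP: t => x t; exists x; rewrite (tuple0 t); apply: val_inj. Qed.

Lemma gates_unitary i : (i < size gates)%N -> unitary_gate (nth dflt_gate gates i).
Proof.
case: i => [|[|[|i]]] //= _.
- move=> a b; have [x ->] := tuple1 a; have [y ->] := tuple1 b.
  rewrite (@big_strings _ _ _ _ predT (fun c => (hgate.2 c [tuple x])^* * hgate.2 c [tuple y])).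
  rewrite big_stringsS !big_seq1 /= !isq2_sign.
  by case: x; case: y; rewrite /= ?expr0 ?expr1 ?mulr1 ?isq2_conj ?isq2_sq ?mulrN1
    ?subrr ?half2.
- move=> a b; have [x ->] := tuple1 a; have [y ->] := tuple1 b.
  rewrite (@big_strings _ _ _ _ predT (fun c => (pgate.2 c [tuple x])^* * pgate.2 c [tuple y])).
  rewrite big_stringsS !big_seq1 /= !isq2_sign.
  by case: x; case: y; rewrite /= ?expr0 ?expr1 ?mulr1 ?isq2_conj ?isq2_sq ?mulrN1
    ?subrr ?half2.
- move=> a b; rewrite (bigD1 (rev_tuple a)) //= eqxx rmorph1 mul1r.
  rewrite (can_eq (@revK _)) big1 ?addr0 // => c ne.
  by rewrite -[_ == rev a]/(c == rev_tuple a) (negbTE ne) rmorph0 mul0r.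
Qed.

(** For strings of equal length n this is the entry 2^(-n/2) (-1)^(y.z) of the n-fold tensor power
    of the Hadamard matrix. *)
Fixpoint hadamard (z y : seq bool) : algC :=
  match z, y with
  | a :: z', c :: y' => isq2 * (-1) ^+ (c && a) * hadamard z' y'
  | _, _ => 1
  end.

Lemma hadamard_sym z y : hadamard z y = hadamard y z.
Proof. by elim: z y => [|a z IH] [|c y] //=; rewrite IH andbC. Qed.

Lemma hadamard0 n y : size y = n -> hadamard (nseq n false) y = isq2 ^+ n.
Proof.
by elim: n y => [|n IH] [|c y] //= [hy]; rewrite IH // andbF mulr1 exprS.
Qed.

Lemma hadamard_real z y : hadamard z y \is Num.real.
Proof.
elim: z y => [|a z IH] [|c y] //=; rewrite !rpredM ?isq2_real ?IH //.
by rewrite rpredX ?rpredN ?rpred1.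
Qed.

Lemma hadamard_ortho n y y' : size y = n -> size y' = n ->
  \sum_(z <- strings n) hadamard y z * hadamard y' z = (y == y')%:R.
Proof.
elim: n y y' => [|n IH] [|a y] [|a' y'] //=; first by rewrite big_seq1 mulr1.
move=> [hy] [hy']; rewrite big_stringsS /=.
have E (c : bool) : \sum_(z <- strings n) isq2 * (-1) ^+ (c && a) * hadamard y z *
    (isq2 * (-1) ^+ (c && a') * hadamard y' z) =
    2%:R^-1 * (-1) ^+ (c && (a (+) a')) * (y == y')%:R.
  rewrite -(IH y y') // mulr_sumr; apply: eq_bigr => z _.
  by rewrite -isq2_sq andb_addr signr_addb; ring.
rewrite (E false) (E true) {E} /= eqseq_cons; case: a; case: a'; case: (y == y');
  rewrite /= ?mulr1 ?mulr0 ?expr0 ?expr1 ?mulrN1 ?addr0 ?subrr ?half2 //.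
Qed.

(** The gates act from left to right; once a qubit is treated, its branch value joins the fixed
    prefix p. *)
Lemma layer_ket A m p z : size (p ++ z) = m ->
  same_on m (run gates A [seq QGate 0 [:: k] | k <- iota (size p) (size z)] (ket (p ++ z)))
    (fun b => \sum_(y <- strings (size z)) hadamard z y * ket (p ++ y) b).
Proof.
elim: z p => [|a z IH] p hm; first by move=> b _; rewrite big_seq1 mul1r.
rewrite /= run_cons.
have hp : (size p < m)%N by rewrite -hm size_cat /=; lia.
have hv : all (valid_qinstr gates m) [seq QGate 0 [:: k] | k <- iota (size p).+1 (size z)].
  rewrite all_map; apply/allP => k; rewrite mem_iota /= andbT -hm size_cat /=; lia.
have hU : (nth dflt_gate gates 0).1 = 1%N by [].
have h1 := gate1_ket A hU hp hm.
have h2 c : c \in [:: false; true] -> same_on m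
    (run gates A [seq QGate 0 [:: k] | k <- iota (size p).+1 (size z)]
      (ket (set_nth false (p ++ a :: z) (size p) c)))
    (fun b => \sum_(y <- strings (size z)) hadamard z y * ket (p ++ c :: y) b).
  move=> _; have -> : set_nth false (p ++ a :: z) (size p) c = rcons p c ++ z.
    by rewrite cat_rcons; elim: (p) => //= x q ->.
  rewrite -(size_rcons p c) => b hb; rewrite IH //; last first.
    by rewrite -hm !size_cat size_rcons /=; lia.
  by apply: eq_bigr => y _; rewrite cat_rcons.
move=> b hb; rewrite (run_expand hv h1 h2) // !big_cons big_nil addr0 big_cat !big_map /=.
rewrite !mulr_sumr nth_cat ltnn subnn /=.
by congr (_ + _); apply: eq_bigr => y _; rewrite mulrA.
Qed.

(** The first gate prepares (|0> - |1>) / sqrt 2, which the query multiplies by its sign, and the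
    second gate maps it to -|1>. So qubit t ends in a known basis state and stays disentangled. *)
Lemma kickback A m qs t s : uniq (t :: qs) -> all (fun p => p < m)%N (t :: qs) ->
  size s = m -> nth false s t = false ->
  same_on m (run gates A [:: QGate 1 [:: t]; QOracle qs t; QGate 1 [:: t]] (ket s))
    (fun b => - (-1) ^+ (A (getbits s qs)) * ket (set_nth false s t true) b).
Proof.
move=> uq hall hs hst; have /andP[tqs _] := uq; have /andP[ht _] := hall.
have hU : (nth dflt_gate gates 1).1 = 1%N by [].
rewrite run_cons; have h1 := gate1_ket A hU ht hs.
have hv : all (valid_qinstr gates m) [:: QOracle qs t; QGate 1 [:: t]].
  by apply/and3P; split=> //; [exact/andP | rewrite /= ht].
set beta := A (getbits s qs).
have h2 c : c \in [:: false; true] -> same_on m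
   (run gates A [:: QOracle qs t; QGate 1 [:: t]] (ket (set_nth false s t c)))
   (fun b => \sum_(c' <- [:: false; true])
      (nth dflt_gate gates 1).2 [:: c'] [:: c (+) beta] * ket (set_nth false s t c') b).
  move=> _; have hsc : size (set_nth false s t c) = m by rewrite size_set_nth_lt hs.
  rewrite run_cons; have hv2 : all (valid_qinstr gates m) [:: QGate 1 [:: t]] by case/andP: hv.
  apply: same_on_trans (run_same A hv2 (oracle_ket gates A tqs ht hsc)) _.
  have -> : getbits (set_nth false s t c) qs = getbits s qs.
    apply/eq_in_map => q qin; rewrite nth_set_nth /=.
    by case: eqP => // e; move: tqs; rewrite -e qin.
  rewrite -/beta nth_set_nth /= eqxx set_set_nth eqxx.
  have hsc' : size (set_nth false s t (c (+) beta)) = m by rewrite size_set_nth_lt hs.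
  move=> b hb; apply: etrans (gate1_ket A hU ht hsc' hb) _.
  by apply: eq_bigr => c' _; rewrite nth_set_nth /= eqxx set_set_nth eqxx.
move=> b hb; rewrite (run_expand hv h1 h2) // !big_cons !big_nil !addr0 hst /=.
have hh := isq2_sq; have h22 := half2.
case: (beta); rewrite /= ?expr0 ?expr1 ?mulr1 ?mulrN1 ?mulNr ?mul1r ?opprK !mulrDr ?mulrN ?mulNr
  ?mulrA !hh.
  rewrite opprD addrACA subrr add0r ?opprK -mulrDl h22 mul1r //.
by rewrite opprD addrACA subrr add0r -opprD -mulrDl h22 mul1r.
Qed.

(** * Zero-error and exact algorithms *)

(** Input, two idle qubits, then answer u at position n + 2 and flag v at n + 3. *)
Definition prefix x u v : seq bool := x ++ [:: false; false; u; v].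
Definition state_of x u v y : seq bool := prefix x u v ++ y.
Definition qubits n : nat := (2 * n + 4)%N.
Definition outcome x u v y : seq bool :=
  exchange (exchange (state_of x u v y) 0 (size x + 2)) 1 (size x + 3).

Lemma size_prefix x u v : size (prefix x u v) = (size x + 4)%N.
Proof. by rewrite size_cat. Qed.

Lemma size_state_of x u v y : size y = size x -> size (state_of x u v y) = qubits (size x).
Proof. by move=> hy; rewrite size_cat size_prefix hy /qubits; lia. Qed.

Lemma nth_state_of x u v y k : (k < 4)%N ->
  nth false (state_of x u v y) (size x + k) = nth false [:: false; false; u; v] k.
Proof. by move=> hk; rewrite nth_cat size_prefix ltn_add2l hk nth_cat ltnNge leq_addr addKn. Qed.

Lemma set_state_of x u v y k c : (k < 4)%N -> set_nth false (state_of x u v y) (size x + k) c =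
  (x ++ set_nth false [:: false; false; u; v] k c) ++ y.
Proof.
move=> hk; rewrite /state_of /prefix -!catA; elim: x => [|a x IH] /=; last by rewrite IH.
by case: k hk => [|[|[|[|k]]]].
Qed.

Lemma getbits_register x u v y : size y = size x ->
  getbits (state_of x u v y) (register (size x)) = y.
Proof.
move=> hy; rewrite /getbits /register map_nth_iota; last first.
  by rewrite size_state_of // /qubits; lia.
by rewrite drop_cat size_prefix ltnn subnn drop0 -hy take_size.
Qed.

Lemma getbits_input x u v y : getbits (state_of x u v y) (iota 0 (size x)) = x.
Proof.
rewrite /getbits map_nth_iota ?drop0; last by rewrite !size_cat; lia.
by rewrite /state_of -catA take_size_cat.
Qed.

Lemma init_stateE x :
  init_state x (qubits (size x)) = ket (state_of x false false (nseq (size x) false)).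
Proof.
apply: functional_extensionality => b; rewrite /init_state /ket.
have -> : x ++ nseq (qubits (size x) - size x) false =
    state_of x false false (nseq (size x) false).
  rewrite /state_of -catA; congr (_ ++ _).
  by have -> : (qubits (size x) - size x = 4 + size x)%N by rewrite /qubits; lia.
by case: eqP.
Qed.

Lemma outcome0 x u v y : nth false (outcome x u v y) 0 = u.
Proof. by rewrite /outcome !nth_exchange /= addn3 addn2 /= -addn2 nth_state_of. Qed.

Lemma outcome1 x u v y : nth false (outcome x u v y) 1 = v.
Proof.
rewrite /outcome nth_exchange addn3 /= nth_exchange -addn3.
have -> : (size x + 3 == size x + 2)%N = false by lia.
have -> : (size x + 3 == 0)%N = false by lia.
by rewrite nth_state_of.
Qed.

Lemma size_outcome x u v y : size y = size x -> size (outcome x u v y) = qubits (size x).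
Proof.
move=> hy; have hs := size_state_of u v hy.
by rewrite /outcome !size_exchange ?size_exchange ?hs // /qubits; lia.
Qed.

Lemma outcome_inj x u v u' v' y y' : size y = size x -> size y' = size x ->
  outcome x u v y = outcome x u' v' y' -> y = y'.
Proof.
move=> hy hy' h; have hs := size_state_of u v hy; have hs' := size_state_of u' v' hy'.
have h1 : exchange (state_of x u v y) 0 (size x + 2) = exchange (state_of x u' v' y') 0 (size x + 2).
  rewrite -[LHS](@exchangeK _ 1 (size x + 3)) -/(outcome x u v y) ?h;
    rewrite ?size_exchange ?hs /qubits; try lia.
  by rewrite /outcome exchangeK ?size_exchange ?hs' /qubits; try lia.
have h2 : state_of x u v y = state_of x u' v' y'.
  rewrite -[LHS](@exchangeK _ 0 (size x + 2)) ?h1 ?exchangeK //;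
    rewrite ?hs ?hs' /qubits; lia.
by move/eqP: h2; rewrite eqseq_cat ?size_prefix // => /andP[_ /eqP].
Qed.

Lemma swaps_ket A x u v y : size y = size x ->
  same_on (qubits (size x)) (run gates A (swaps (size x)) (ket (state_of x u v y)))
    (ket (outcome x u v y)).
Proof.
move=> hy; have hs := size_state_of u v hy.
have hE g p q s := @exchange_ket gates A (qubits (size x)) g p q s.
rewrite /swaps run_cons.
have hv : all (valid_qinstr gates (qubits (size x))) [:: QGate 2 [:: 1%N; (size x + 3)%N]].
  by rewrite /= inE /qubits; lia.
apply: same_on_trans (run_same A hv _) _; first by apply: hE => //; rewrite /qubits; lia.
apply: hE => //; try by rewrite /qubits; lia.
by rewrite size_exchange hs /qubits; lia.
Qed.

Lemma swaps_valid n : all (valid_qinstr gates (qubits n)) (swaps n).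
Proof. by rewrite /= !inE /qubits; lia. Qed.

Lemma layer_valid n : all (valid_qinstr gates (qubits n)) (layer n).
Proof.
rewrite all_map; apply/allP => k; rewrite mem_iota /= andbT /qubits; lia.
Qed.

Lemma query_valid n qs t : uniq qs -> t \notin qs -> (t < qubits n)%N ->
  all (fun p => (p < qubits n)%N) qs -> valid_qinstr gates (qubits n) (QOracle qs t).
Proof. by move=> /= -> -> -> ->. Qed.

Lemma register_lt n : all (fun p => (p < qubits n)%N) (register n).
Proof. by apply/allP => k; rewrite mem_iota /qubits; lia. Qed.

Lemma kick_valid n : all (valid_qinstr gates (qubits n))
  [:: QGate 1 [:: (n + 3)%N]; QOracle ((n + 2)%N :: register n) (n + 3); QGate 1 [:: (n + 3)%N]].
Proof.
have h : (n + 3 < qubits n)%N by rewrite /qubits; lia.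
apply/and4P; split=> //; try by rewrite /= h.
apply: query_valid => //.
- by rewrite /= iota_uniq mem_iota andbT; lia.
- by rewrite inE mem_iota; lia.
- by rewrite /= register_lt andbT /qubits; lia.
Qed.

Lemma nor_valid n :
  valid_qinstr gates (qubits n) (QOracle ((n + 3)%N :: register n) (n + 2)).
Proof.
apply: query_valid; rewrite /= ?iota_uniq ?inE ?mem_iota ?register_lt /qubits; lia.
Qed.

Lemma deutsch_valid n : all (valid_qinstr gates (qubits n)) (deutsch n).
Proof.
rewrite !all_cat layer_valid kick_valid !andTb.
by apply/andP; split; [exact: nor_valid | exact: swaps_valid].
Qed.

Lemma flag_valid n :
  valid_qinstr gates (qubits n) (QOracle (iota 0 n ++ register n) (n + 3)).
Proof.
apply: query_valid.
- by rewrite cat_uniq !iota_uniq andbT; apply/hasPn => k; rewrite /= !mem_iota; lia.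
- by rewrite mem_cat !mem_iota; lia.
- by rewrite /qubits; lia.
- by rewrite all_cat register_lt andbT; apply/allP => k; rewrite mem_iota /qubits; lia.
Qed.

Lemma value_valid n :
  valid_qinstr gates (qubits n) (QOracle (iota 0 n ++ register n ++ [:: n]) (n + 2)).
Proof.
apply: query_valid.
- rewrite catA cats1 rcons_uniq mem_cat !mem_iota cat_uniq !iota_uniq andbT.
  apply/andP; split; first lia.
  by apply/hasPn => k; rewrite /= !mem_iota; lia.
- by rewrite !mem_cat !mem_iota inE; lia.
- by rewrite /qubits; lia.
- rewrite !all_cat register_lt /= andbT; apply/andP; split; last by rewrite /qubits; lia.
  by apply/allP => k; rewrite mem_iota /qubits; lia.
Qed.

Lemma trial_valid n : all (valid_qinstr gates (qubits n)) (trial n).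
Proof.
rewrite all_cat layer_valid andTb.
by apply/and3P; split; [exact: flag_valid | exact: value_valid | exact: swaps_valid].
Qed.

Lemma layer_state A x u v y : size y = size x ->
  same_on (qubits (size x)) (run gates A (layer (size x)) (ket (state_of x u v y)))
    (fun b => \sum_(z <- strings (size x)) hadamard y z * ket (state_of x u v z) b).
Proof.
move=> hy; have := @layer_ket A (qubits (size x)) (prefix x u v) y (size_state_of u v hy).
by rewrite size_prefix hy.
Qed.

(** The coefficient of z after the second Hadamard layer; the minus sign comes from the kickback. *)
Definition amplitude (b : seq bool -> bool) n (z : seq bool) : algC :=
  \sum_(y <- strings n) isq2 ^+ n * (- (-1) ^+ b y * hadamard y z).

Lemma deutsch_final A b x :
  (forall y, size y = size x -> A (false :: y) = b y) ->
  (forall z, A (true :: z) = ~~ has id z) ->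
  same_on (qubits (size x)) (final_state gates A (qubits (size x)) (deutsch (size x)) x)
    (fun w => \sum_(z <- strings (size x))
        amplitude b (size x) z * ket (outcome x (~~ has id z) true z) w).
Proof.
move=> hb hnor; set n := size x; set m := qubits n.
rewrite /final_state -/(run gates A (deutsch n) _) init_stateE /deutsch run_cat.
have tail_valid := deutsch_valid n; rewrite /deutsch all_cat in tail_valid.
case/andP: tail_valid => _ tail_valid.
have tail2_valid := tail_valid; rewrite all_cat in tail2_valid.
case/andP: tail2_valid => _ tail2_valid.
have tail3_valid := tail2_valid; rewrite all_cat in tail3_valid.
case/andP: tail3_valid => _ tail3_valid.
have s0 : size (nseq n false) = n by rewrite size_nseq.
have H y : y \in strings n -> same_on m
    (run gates A ([:: QGate 1 [:: (n + 3)%N]; QOracle ((n + 2)%N :: register n) (n + 3);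
      QGate 1 [:: (n + 3)%N]] ++ layer n ++ QOracle ((n + 3)%N :: register n) (n + 2) :: swaps n)
      (ket (state_of x false false y)))
    (fun w => - (-1) ^+ b y * \sum_(z <- strings n)
       hadamard y z * ket (outcome x (~~ has id z) true z) w).
  move=> /size_strings hy; rewrite run_cat.
  have hk : same_on m (run gates A [:: QGate 1 [:: (n + 3)%N];
      QOracle ((n + 2)%N :: register n) (n + 3); QGate 1 [:: (n + 3)%N]]
        (ket (state_of x false false y)))
      (fun w => - (-1) ^+ b y * ket (state_of x false true y) w).
    have /and4P[_ /andP[h1 h2] _ _] := kick_valid n.
    have := @kickback A m _ _ (state_of x false false y) h1 h2 (size_state_of _ _ hy).
    rewrite nth_state_of // set_state_of // => /(_ erefl).
    by rewrite /= -/(getbits _ _) getbits_register // nth_state_of //= hb.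
  apply: same_on_trans (run_scale A tail2_valid hk) _ => w hw; congr (_ * _).
  rewrite run_cat; move: w hw; apply: run_expand tail3_valid (layer_state A false true hy) _.
  move=> z /size_strings hz; rewrite run_cons.
  apply: same_on_trans (swaps_ket A _ _ hz); apply: run_same; first exact: swaps_valid.
  have /andP[/andP[h1 _] /andP[h2 _]] := nor_valid n.
  have := @oracle_ket gates A m _ _ (state_of x false true z) h1 h2 (size_state_of _ _ hz).
  rewrite nth_state_of // set_state_of //=.
  by rewrite /getbits /= -/(getbits _ _) getbits_register // nth_state_of //= hnor.
apply: same_on_trans (run_expand tail_valid (layer_state A false false s0) H) _ => w hw.
rewrite /amplitude; under eq_bigr => y _ do rewrite mulr_sumr mulr_sumr.
rewrite exchange_big /=; apply: eq_bigr => z _; rewrite mulr_suml.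
rewrite !big_seq; apply: eq_bigr => y /size_strings hy.
by rewrite hadamard0 // !mulrA.
Qed.

Lemma trial_final A x :
  same_on (qubits (size x)) (final_state gates A (qubits (size x)) (trial (size x)) x)
    (fun w => \sum_(r <- strings (size x))
        isq2 ^+ size x * ket (outcome x (A (x ++ r ++ [:: false])) (A (x ++ r)) r) w).
Proof.
set n := size x; set m := qubits n.
rewrite /final_state -/(run gates A (trial n) _) init_stateE /trial run_cat.
have tail_valid := trial_valid n; rewrite /trial all_cat in tail_valid.
case/andP: tail_valid => _ tail_valid.
have s0 : size (nseq n false) = n by rewrite size_nseq.
have H r : r \in strings n -> same_on m
   (run gates A (QOracle (iota 0 n ++ register n) (n + 3)
     :: QOracle (iota 0 n ++ register n ++ [:: n]) (n + 2) :: swaps n)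
      (ket (state_of x false false r)))
   (ket (outcome x (A (x ++ r ++ [:: false])) (A (x ++ r)) r)).
  move=> /size_strings hr; rewrite 2!run_cons.
  have /andP[/andP[h1 _] /andP[h2 _]] := flag_valid n.
  have := @oracle_ket gates A m _ _ (state_of x false false r) h1 h2 (size_state_of _ _ hr).
  rewrite nth_state_of // set_state_of //= {1}/getbits map_cat -!/(getbits _ _).
  rewrite getbits_input getbits_register // => e1.
  have /andP[/andP[h3 _] /andP[h4 _]] := value_valid n.
  have := @oracle_ket gates A m _ _ (state_of x false (A (x ++ r)) r) h3 h4 (size_state_of _ _ hr).
  rewrite nth_state_of // set_state_of //= {1}/getbits !map_cat -!/(getbits _ _).
  rewrite getbits_input getbits_register //= -[X in nth false _ X]addn0 nth_state_of //= => e2.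
  apply: same_on_trans (swaps_ket A _ _ hr); apply: run_same; first exact: swaps_valid.
  apply: same_on_trans _ e2.
  exact: (@apply_same gates A m _ _ _ (value_valid n) e1).
apply: same_on_trans (run_expand tail_valid (layer_state A false false s0) H) _ => w hw.
by rewrite !big_seq; apply: eq_bigr => y /size_strings hy; rewrite hadamard0.
Qed.

Lemma isq2_exp n : isq2 ^+ n * isq2 ^+ n = (2 ^ n)%:R^-1.
Proof. by rewrite -exprMn isq2_sq exprVn natrX. Qed.

Lemma sum_strings_const n (c : algC) : \sum_(y <- strings n) c = (2 ^ n)%:R * c.
Proof. by rewrite big_const_seq count_predT size_strings_card iter_addr_0 mulr_natl. Qed.

Lemma pow2_neq0 n : (2 ^ n)%:R != 0 :> algC.
Proof. by rewrite pnatr_eq0 -lt0n expn_gt0. Qed.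

Lemma real_sqr_norm (a : algC) : a \is Num.real -> `|a| ^+ 2 = a * a.
Proof. by move=> ha; rewrite real_normK // expr2. Qed.

Lemma isq2_norm n : `|isq2 ^+ n| ^+ 2 = (2 ^ n)%:R^-1.
Proof. by rewrite real_sqr_norm ?rpredX ?isq2_real // isq2_exp. Qed.

Lemma amplitude_real b n z : amplitude b n z \is Num.real.
Proof.
apply: rpred_sum => y _; apply: rpredM; first by rewrite rpredX ?isq2_real.
by rewrite rpredM ?hadamard_real // rpredN rpredX // rpredN rpred1.
Qed.

(** Parseval: by orthogonality of the Hadamard rows only the diagonal terms survive, and each of the
    2^n of them contributes 2^(-n). *)
Lemma amplitude_norm b n : \sum_(z <- strings n) `|amplitude b n z| ^+ 2 = 1.
Proof.
under eq_bigr => z _ do rewrite real_sqr_norm ?amplitude_real // [X in X * _]/amplitude mulr_suml.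
rewrite exchange_big /=.
have E y : y \in strings n -> \sum_(z <- strings n)
    isq2 ^+ n * (- (-1) ^+ b y * hadamard y z) * amplitude b n z = (2 ^ n)%:R^-1.
  move=> yS; rewrite /amplitude; under eq_bigr => z _ do rewrite mulr_sumr.
  rewrite exchange_big /= (bigD1_seq y) ?strings_uniq //= [X in _ + X]big_seq_cond.
  have F y' : y' \in strings n -> \sum_(z <- strings n) isq2 ^+ n * (- (-1) ^+ b y * hadamard y z) *
      (isq2 ^+ n * (- (-1) ^+ b y' * hadamard y' z)) =
      (2 ^ n)%:R^-1 * ((-1) ^+ b y * (-1) ^+ b y') * (y == y')%:R.
    move=> y'S; rewrite -(hadamard_ortho (size_strings yS) (size_strings y'S)) mulr_sumr.
    by apply: eq_bigr => z _; rewrite -isq2_exp; ring.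
  rewrite F // eqxx mulr1 -signr_addb addbb mulr1 big1 ?addr0 // => y' /andP[y'S ne].
  by rewrite F // eq_sym (negbTE ne) mulr0.
rewrite big_seq (eq_bigr (fun=> (2 ^ n)%:R^-1)) => [|y yS]; last exact: E.
by rewrite -big_seq sum_strings_const divff ?pow2_neq0.
Qed.

Lemma amplitude0 b n : amplitude b n (nseq n false) =
  - ((2 ^ n)%:R^-1 * \sum_(y <- strings n) (-1) ^+ b y).
Proof.
rewrite /amplitude mulr_sumr -sumrN !big_seq; apply: eq_bigr => y /size_strings hy.
by rewrite hadamard_sym hadamard0 // -isq2_exp; ring.
Qed.

(** The amplitude at zero is, up to sign, the mean of the signs (-1)^([sel o y]): all are -1 in the
    constant case, and they cancel in the balanced case. *)
Lemma amplitude0_valid o x : valid o (size x) ->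
  `|amplitude (sel o) (size x) (nseq (size x) false)| ^+ 2 = (Llang o x)%:R.
Proof.
set n := size x; case=> _ _; rewrite amplitude0 => -[hall|hbal].
  have -> : Llang o x by apply/forallP => y; rewrite hall // size_tuple.
  have -> : \sum_(y <- strings n) (-1) ^+ sel o y = (2 ^ n)%:R * -1 :> algC.
    rewrite -sum_strings_const !big_seq; apply: eq_bigr => y /size_strings hy.
    by rewrite hall // expr1.
  by rewrite mulrA mulVf ?pow2_neq0 // mul1r opprK normr1 expr1n.
have -> : Llang o x = false.
  apply/negP => /forallP h; move: hbal.
  have -> : [set y : n.-tuple bool | sel o y] = setT by apply/setP => y; rewrite !inE h.
  by rewrite cardsT card_tuple card_bool; have := expn_gt0 2 n; lia.
have -> : \sum_(y <- strings n) (-1) ^+ sel o y = 0 :> algC.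
  rewrite -(@big_strings _ _ _ n predT (fun y => (-1) ^+ sel o y)) /=.
  set S := [set y : n.-tuple bool | sel o y] in hbal.
  rewrite (bigID (mem S)) /= (eq_bigr (fun=> -1)) => [|y]; last first.
    by rewrite inE => ->; rewrite expr1.
  rewrite [X in _ + X](eq_bigr (fun=> 1)) => [|y]; last first.
    by rewrite inE => /negbTE ->; rewrite expr0.
  rewrite [X in _ + X](eq_bigl (mem (~: S))) => [|y]; last by rewrite !inE.
  rewrite !sumr_const mulNrn.
  have := cardsC S; rewrite card_tuple card_bool -hbal -addnn => /addnI ->.
  by rewrite addNr.
by rewrite mulr0 oppr0 normr0 expr0n.
Qed.

Definition Blang (o : odata) : lang := fun w =>
  match w with
  | [::] => true
  | true :: y => ~~ has id y
  | false :: y => sel o y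
  end.

Section Upper.
Variable o : odata.
Hypothesis o_valid : forall n, valid o n.

Lemma answerP w r : size r = size w -> answer o w r = None \/ answer o w r = Some (Blang o w).
Proof.
case: w => [|[] y] /= hr; [by right|by right|].
by have [h _ _] := o_valid (size y); exact: h.
Qed.

Lemma answer_count w :
  (2 ^ size w <= 2 * #|[set r : (size w).-tuple bool | isSome (answer o w r)]|)%N.
Proof.
have full k : (2 ^ k <= 2 * #|[set r : k.-tuple bool | true]|)%N.
  have -> : [set r : k.-tuple bool | true] = setT by apply/setP => r; rewrite !inE.
  by rewrite cardsT card_tuple card_bool; lia.
case: w => [|[] y] /=; try exact: full.
by have [_ h _] := o_valid (size y); rewrite expnS leq_mul2l /=; exact: h.
Qed.

Lemma oracle_flag w r : size r = size w -> oracle o (w ++ r) = isSome (answer o w r).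
Proof.
move=> hr; rewrite /oracle size_cat hr addnn odd_double doubleK /probe.
by rewrite take_size_cat // drop_size_cat // -hr take_size.
Qed.

(** The bit c only makes the length odd; halving with rounding down discards it. *)
Lemma oracle_value w r c : size r = size w ->
  oracle o (w ++ r ++ [:: c]) = odflt false (answer o w r).
Proof.
move=> hr; rewrite /oracle !size_cat hr addn1 addnS addnn /= odd_double uphalf_double /probe.
by rewrite take_size_cat // drop_size_cat // take_size_cat.
Qed.

Lemma oracle_sound w r c : size r = size w -> oracle o (w ++ r) ->
  oracle o (w ++ r ++ [:: c]) = Blang o w.
Proof.
by move=> hr; rewrite oracle_flag // oracle_value //; case: (answerP hr) => ->.
Qed.

Lemma deutsch_prob x P :
  prob_of (qubits (size x)) P
    (final_state gates (Blang o) (qubits (size x)) (deutsch (size x)) x) =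
  \sum_(z <- strings (size x) | P (outcome x (~~ has id z) true z))
    `|amplitude (sel o) (size x) z| ^+ 2.
Proof.
apply: prob_outcomes (@deutsch_final (Blang o) (sel o) x _ _) => //.
- exact: strings_uniq.
- by move=> y z /size_strings hy /size_strings hz /outcome_inj; apply.
- by move=> y /size_strings hy; exact: size_outcome.
Qed.

Lemma trial_prob x P :
  prob_of (qubits (size x)) P
    (final_state gates (oracle o) (qubits (size x)) (trial (size x)) x) =
  \sum_(r <- strings (size x)
     | P (outcome x (oracle o (x ++ r ++ [:: false])) (oracle o (x ++ r)) r)) (2 ^ size x)%:R^-1.
Proof.
rewrite (prob_outcomes (a := fun=> isq2 ^+ size x) P _ _ _ (@trial_final (oracle o) x)).
- by apply: eq_bigr => r _; exact: isq2_norm.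
- exact: strings_uniq.
- by move=> y z /size_strings hy /size_strings hz /outcome_inj; apply.
- by move=> y /size_strings hy; exact: size_outcome.
Qed.

Lemma strings_filter0 n : [seq z <- strings n | ~~ has id z] = [:: nseq n false].
Proof.
elim: n => //= n IH; rewrite filter_cat !filter_map.
rewrite [X in map (cons false) X](eq_filter (a2 := fun z => ~~ has id z)) // IH.
by rewrite [X in map (cons true) X](eq_filter (a2 := pred0)) // filter_pred0.
Qed.

Lemma deutsch_accept x : \sum_(z <- strings (size x) | ~~ has id z)
  `|amplitude (sel o) (size x) z| ^+ 2 = (Llang o x)%:R.
Proof. by rewrite -big_filter strings_filter0 big_seq1 amplitude0_valid. Qed.

Lemma qwf_code f x ins : decode (f x) = [:: qubits (size x)] :: map qcode ins ->
  all (valid_qinstr gates (qubits (size x))) ins -> qwf gates f x.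
Proof.
move=> e hv; exists (qubits (size x)), ins; rewrite e parse_q_code; split=> //; split=> //.
by rewrite /qubits; lia.
Qed.

Lemma deutsch_family : exists2 f, qfamily gates f & forall A x P, qprob gates f A x P =
  prob_of (qubits (size x)) P (final_state gates A (qubits (size x)) (deutsch (size x)) x).
Proof.
have [f fpoly fE] := deutsch_poly; exists f; last by move=> A x P; rewrite /qprob fE parse_q_code.
by split=> // [|x]; [exact: gates_unitary | exact: qwf_code (fE x) (deutsch_valid _)].
Qed.

Lemma trial_family : exists2 f, qfamily gates f & forall A x P, qprob gates f A x P =
  prob_of (qubits (size x)) P (final_state gates A (qubits (size x)) (trial (size x)) x).
Proof.
have [f fpoly fE] := trial_poly; exists f; last by move=> A x P; rewrite /qprob fE parse_q_code.
by split=> // [|x]; [exact: gates_unitary | exact: qwf_code (fE x) (trial_valid _)].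
Qed.

Lemma Llang_EQP : EQP (Blang o) (Llang o).
Proof.
have [f fam fE] := deutsch_family; exists gates, f; split=> // x.
rewrite fE deutsch_prob -deutsch_accept; apply: eq_bigl => z.
by rewrite outcome0.
Qed.

(** The flag read at qubit 1 is always set, so the exact circuit is correct with probability 1 and
    never wrong. *)
Lemma Llang_ZQP : ZQP (Blang o) (Llang o).
Proof.
have [f fam fE] := deutsch_family; exists gates, f; split=> // x.
rewrite !fE !deutsch_prob.
under eq_bigl => z do rewrite outcome0 outcome1 /=.
under [X in _ <= X]eq_bigl => z do rewrite outcome0 outcome1 /=.
have hn := amplitude_norm (sel o) (size x); have ha := deutsch_accept x.
rewrite (bigID (fun z => ~~ has id z)) ha /= in hn.
have h0 : \sum_(z <- strings (size x) | (~~ has id z) != Llang o x)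
    `|amplitude (sel o) (size x) z| ^+ 2 = 0.
  case: (Llang o x) ha hn => ha hn.
    rewrite (eq_bigl (fun z => ~~ ~~ has id z)) => [|z]; last by case: (has id z).
    by apply: (@addrI _ 1); rewrite addr0.
  rewrite (eq_bigl (fun z => ~~ has id z)) => [|z]; last by case: (has id z).
  exact: ha.
split=> //; have := amplitude_norm (sel o) (size x).
rewrite (bigID (fun z => (~~ has id z) == Llang o x)) /= h0 addr0 => ->.
by rewrite invf_le1 ?ler1n ?ltr0n.
Qed.

Lemma Blang_ZQP : ZQP (oracle o) (Blang o).
Proof.
have [f fam fE] := trial_family; exists gates, f; split=> // x.
rewrite !fE !trial_prob; split.
  rewrite big_seq_cond big1 // => r /andP[/size_strings hr].
  by rewrite outcome0 outcome1 => /andP[hfl]; rewrite oracle_sound // eqxx.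
have -> : \sum_(r <- strings (size x) | nth false (outcome x (oracle o (x ++ r ++ [:: false]))
     (oracle o (x ++ r)) r) 1 && (nth false (outcome x (oracle o (x ++ r ++ [:: false]))
     (oracle o (x ++ r)) r) 0 == Blang o x)) (2 ^ size x)%:R^-1 =
   \sum_(r : (size x).-tuple bool | isSome (answer o x r)) (2 ^ size x)%:R^-1 :> algC.
  rewrite (@big_strings _ _ _ _ (fun r => isSome (answer o x r)) (fun=> (2 ^ size x)%:R^-1)).
  rewrite big_seq_cond [RHS]big_seq_cond; apply: eq_bigl => r.
  case: (boolP (r \in _)) => //= /size_strings hr.
  rewrite outcome0 outcome1 -oracle_flag //; case: (boolP (oracle o (x ++ r))) => //= hfl.
  by rewrite oracle_sound // eqxx.
rewrite sumr_const -[X in _ <= X]mulr_natl; have := answer_count x; rewrite cardsE => hc.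
rewrite ler_pdivlMr ?ltr0n ?expn_gt0 // mulrC ler_pdivrMr ?ltr0n //.
by rewrite -natrM ler_nat mulnC.
Qed.

Lemma Blang_ZPP : ZPP (oracle o) (Blang o).
Proof.
have [f fpoly fE] := zpp_poly; exists f; split=> // x.
set n := size x; exists n, (2 * n + 1)%N, (2 * n)%N, (zpp_trial n); split; first exact: fE.
have E (r : n.-tuple bool) : ceval x r (oracle o) (zpp_trial n) =
    x ++ r ++ [:: oracle o (x ++ r); oracle o (x ++ r ++ [:: oracle o (x ++ r)])].
  have wires ws k (v : seq bool) : size v = n ->
      (forall ws i, cstep x r (oracle o) ws [:: k; i] = nth false v i) ->
      foldl (fun ws l => rcons ws (cstep x r (oracle o) ws l)) ws
        [seq [:: k; i] | i <- iota 0 n] = ws ++ v.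
    move=> hv hk; suff H j : (j <= n)%N ->
        foldl (fun ws l => rcons ws (cstep x r (oracle o) ws l)) ws
          [seq [:: k; i] | i <- iota 0 j] = ws ++ take j v.
      by rewrite H // -hv take_size.
    elim: j => [|j IH] hj; first by rewrite take0 cats0.
    rewrite -addn1 iotaD map_cat foldl_cat IH ?(ltnW hj) // add0n.
    rewrite -[LHS]/(rcons (ws ++ take j v) (cstep x r (oracle o) (ws ++ take j v) [:: k; j])).
    by rewrite hk addn1 (take_nth false) ?hv // rcons_cat.
  rewrite /ceval /zpp_trial !foldl_cat (wires _ 1%N x) // (wires _ 2%N r) ?size_tuple //.
  rewrite /= !map_nth_iota0 ?size_rcons ?size_cat ?size_tuple; try lia.
  have sz : size (x ++ r) = (2 * n)%N by rewrite size_cat size_tuple mul2n addnn.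
  rewrite -sz take_size addn1 -(size_rcons (x ++ r) (oracle o (x ++ r))) take_size.
  by rewrite -!cats1 -!catA.
have hr (r : n.-tuple bool) : size r = size x by rewrite size_tuple.
have Ef (r : n.-tuple bool) : nth false (ceval x r (oracle o) (zpp_trial n)) (2 * n) = oracle o (x ++ r).
  rewrite E catA nth_cat size_cat size_tuple -/n.
  have -> : (2 * n < n + n)%N = false by lia.
  by have -> : (2 * n - (n + n) = 0)%N by lia.
have Ea (r : n.-tuple bool) : nth false (ceval x r (oracle o) (zpp_trial n)) (2 * n + 1) =
    oracle o (x ++ r ++ [:: oracle o (x ++ r)]).
  rewrite E catA nth_cat size_cat size_tuple -/n.
  have -> : (2 * n + 1 < n + n)%N = false by lia.
  by have -> : (2 * n + 1 - (n + n) = 1)%N by lia.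
split=> [r|]; first by rewrite Ef Ea => hfl; exact: oracle_sound.
apply: leq_trans (answer_count x) _; rewrite leq_mul2l /=; apply/eq_leq/eq_card => r.
by rewrite !inE Ef oracle_flag.
Qed.

End Upper.

(** As flagged answers are never wrong, a flagged acceptance has positive probability exactly on the
    language. This brings ZQP under the same diagonalization as NQP. *)
Lemma ZQP_accepts A L : ZQP A L -> exists G f, qfamily G f /\
  forall x, (0 < qprob G f A x (event true)) = L x.
Proof.
case=> G [f [fam H]]; exists G, f; split=> // x; have [h1 h2] := H x.
case: (L x) h1 h2 => h1 h2.
  have -> : qprob G f A x (event true) =
      qprob G f A x (fun b => nth false b 1 && (nth false b 0 == true)).
    rewrite /qprob; case: parse_q => [[m ins]|] //; apply: eq_bigl => b.
    by rewrite /event eqb_id andbC.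
  by apply: lt_le_trans h2; rewrite invr_gt0 ltr0n.
have -> : qprob G f A x (event true) =
    qprob G f A x (fun b => nth false b 1 && (nth false b 0 != false)).
  rewrite /qprob; case: parse_q => [[m ins]|] //; apply: eq_bigl => b.
  by rewrite /event eqbF_neg negbK andbC.
by rewrite h1 ltxx.
Qed.

Theorem theorem2 :
  exists A : lang,
    (exists L : lang, (exists B : lang, ZPP A B /\ EQP B L) /\ ~ NQP A L) /\
    (exists L : lang, (exists B : lang, ZQP A B /\ ZQP B L) /\ ~ ZQP A L).
Proof.
have [hv hdiag] := diagonal; exists (oracle limit); split; exists (Llang limit); split.
- by exists (Blang limit); split; [exact: Blang_ZPP | exact: Llang_EQP].
- case=> G [f [fam H]]; apply: (hdiag G f false fam) => x; rewrite -H.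
  congr (_ < _); rewrite /qprob; case: parse_q => [[m ins]|] //.
  by apply: eq_bigl => b; rewrite /event andbT.
- by exists (Blang limit); split; [exact: Blang_ZQP | exact: Llang_ZQP].
- by case/ZQP_accepts => G [f [fam H]]; exact: (hdiag G f true fam).
Qed.
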